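(* Let $\psi^{(i)}_{j,k}$ be the periodized wavelets on $\mathbb{T}^d=\mathbb{R}^d/\mathbb{Z}^d$ associated with an orthonormal $0$-smooth wavelet basis of $\mathbb{R}^d$ whose wavelets are continuous. Let $(\chi^i_{j,k})_{i,j,k}$ be a sequence of I.I.D. unbounded random variables of common law $\chi$. For almost every function $f$ in $C(\mathbb{T}^d)$ (i.e. for all $f$ in a prevalent subset of $C(\mathbb{T}^d)$), the associated randomized wavelet series $$X_f=\sum_{i,j,k}c^i_{j,k}\,\chi^i_{j,k}\,\psi^{(i)}_{j,k},$$ where the $c^i_{j,k}$ are the wavelet coefficients of $f$, is almost surely nowhere locally bounded.
   Context: An orthonormal $r$-smooth ($r\ge 0$) wavelet basis on $\mathbb{R}^d$ is a collection of functions $\varphi$ and $\Psi^{(i)}$, $i\in\{1,\dots,2^d-1\}$, such that: $\varphi$, the $\Psi^{(i)}$ and all their partial derivatives up to order $r$ have fast decay (faster than any negative power of $1+|x|$); and the functions $\varphi(\cdot-k)$, $k\in\mathbb{Z}^d$, together with $2^{dj/2}\Psi^{(i)}(2^j\cdot-k)$, $j\in\mathbb{N}$, $k\in\mathbb{Z}^d$, $i\in\{1,\dots,2^d-1\}$, form an orthonormal basis of $L^2(\mathbb{R}^d)$. The periodized wavelets on $\mathbb{T}^d$ are $\psi^{(i)}_{j,k}(x)=\sum_{l\in\mathbb{Z}^d}\Psi^{(i)}(2^j(x-l)-k)$, for $i\in\{1,\dots,2^d-1\}$, $j\in\mathbb{N}$, $k\in\mathbb{Z}^d$ with $2^{-j}k\in[0,1)^d$;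 together with the constant function $1$ they give the periodized wavelet basis. No $L^2$ normalization is used: the wavelet coefficients of $f$ are $c^i_{j,k}=2^{dj}\int_{\mathbb{T}^d}f\,\psi^{(i)}_{j,k}$. A random variable $\chi$ is unbounded if $\mathbb{P}(|\chi|\ge A)>0$ for all $A>0$. A (formal) wavelet series is nowhere locally bounded if there is no nonempty open set $U\subset\mathbb{T}^d$ such that its partial sums over scales $j\le J$ converge, as $J\to\infty$ and in the sense of distributions on $U$, to a function of $L^\infty(U)$. Prevalence: let $E$ be a complete metric vector space. A Borel set $A\subset E$ is Haar-null if there exists a compactly supported probability measure $\mu$ on $E$ such that $\mu(x+A)=0$ for all $x\in E$. A subset of $E$ is Haar-null if it is contained in a Haar-null Borel set. The complement of a Haar-null set is called prevalent. ''Almost every'' is meant in this sense, with $E=C(\mathbb{T}^d)$ equipped with the sup norm. *)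

(* Defs.v *)
From HB Require Import structures.
From mathcomp Require Import all_boot all_order all_algebra.
From mathcomp Require Import all_classical all_reals all_analysis.
From mathcomp Require Import lra.
From mathcomp.analysis.showcase Require summability.

Set Implicit Arguments.
Unset Strict Implicit.
Unset Printing Implicit Defensive.
Import Order.TTheory GRing.Theory Num.Theory.
Import numFieldNormedType.Exports.
Local Open Scope classical_set_scope.
Local Open Scope ring_scope.

Definition measure_rV_display : measure_display.
Proof. exact: default_measure_display. Qed.

Section measurable_rV.
Context {R : realType} (n : nat).

Let coord : 'I_n -> 'rV[R]_n -> measurableTypeR R := fun i x => x 0 i.

Let rV_set0 : g_sigma_preimage coord set0.
Proof. exact: sigma_algebra0. Qed.

Let rV_setC A : g_sigma_preimage coord A -> g_sigma_preimage coord (~` A).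
Proof. exact: sigma_algebraC. Qed.

Let rV_bigcup (F : _^nat) : (forall i, g_sigma_preimage coord (F i)) ->
  g_sigma_preimage coord (\bigcup_i (F i)).
Proof. exact: sigma_algebra_bigcup. Qed.

(* The sigma-algebra generated by the n coordinates, as the library does for
   n.-tuple; on 'rV[R]_n it is the Borel sigma-algebra. *)
HB.instance Definition _ := @isMeasurable.Build measure_rV_display
  'rV[R]_n (g_sigma_preimage coord) rV_set0 rV_setC rV_bigcup.

End measurable_rV.

Lemma measurable_coord (R : realType) n (i : 'I_n) :
  measurable_fun setT (fun x : 'rV[R]_n => x 0 i : measurableTypeR R).
Proof.
move=> _ Y mY; rewrite setTI; apply: sub_sigma_algebra => /=.
rewrite -bigcup_seq/=; exists i => /=; first by rewrite mem_index_enum.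
by exists Y => //; rewrite setTI.
Qed.

Lemma measurable_fun_rV d (T : measurableType d) (R : realType) n
    (f : T -> 'rV[R]_n) :
  (forall i, measurable_fun setT (fun t => f t 0 i : measurableTypeR R)) ->
  measurable_fun setT f.
Proof.
move=> mf _ Y mY; rewrite setTI.
suff : [set A | measurable (f @^-1` A)] Y by [].
move: Y mY; apply: smallest_sub.
  split => /=; first by rewrite preimage_set0.
  - by move=> A mA; rewrite setTD preimage_setC; exact: measurableC.
  - by move=> F mF; rewrite preimage_bigcup; exact: bigcup_measurable.
move=> A /=; rewrite -bigcup_seq/= => -[i _ [B mB <-]].
by rewrite setTI; have := mf i measurableT B mB; rewrite setTI.
Qed.

Definition rV_cons {R : realType} {n : nat}
  (p : measurableTypeR R * 'rV[R]_n) : 'rV[R]_n.+1 :=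
  \row_i oapp (p.2 0) (p.1 : R) (unlift ord0 i).

Lemma measurable_rV_cons (R : realType) n :
  measurable_fun setT (@rV_cons R n).
Proof.
apply: measurable_fun_rV => i; rewrite /rV_cons.
under eq_fun do rewrite mxE.
case: (unlift ord0 i) => [j|] /=; last exact: measurable_fst.
exact: (measurableT_comp (measurable_coord j) measurable_snd).
Qed.

Section lebesgue_cons.
Context {R : realType} {n : nat} (mu : {measure set 'rV[R]_n -> \bar R}).

Definition lebesgue_cons : set 'rV[R]_n.+1 -> \bar R :=
  pushforward (@lebesgue_measure R \x^ mu)%E rV_cons.

Let lebesgue_cons0 : lebesgue_cons set0 = 0%E.
Proof. by rewrite /lebesgue_cons /pushforward preimage_set0 measure0. Qed.

Let lebesgue_cons_ge0 A : (0 <= lebesgue_cons A)%E.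
Proof. by rewrite /lebesgue_cons /pushforward; exact: measure_ge0. Qed.

Let lebesgue_cons_sigma_additive : semi_sigma_additive lebesgue_cons.
Proof.
apply: (@measure_semi_sigma_additive _ _ _ (pushforward _ rV_cons)).
exact: measurable_rV_cons.
Qed.

HB.instance Definition _ := isMeasure.Build _ _ _ lebesgue_cons
  lebesgue_cons0 lebesgue_cons_ge0 lebesgue_cons_sigma_additive.

End lebesgue_cons.

Fixpoint lebesgue_rV {R : realType} (n : nat) :
    {measure set 'rV[R]_n -> \bar R} :=
  match n with
  | 0 => \d_(0 : 'rV[R]_0)
  | m.+1 => lebesgue_cons (lebesgue_rV m)
  end.
Arguments lebesgue_rV : clear implicits.

Lemma lebesgue_rV_box (R : realType) n (A : 'I_n -> set (measurableTypeR R)) :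
  (forall i, measurable (A i)) ->
  lebesgue_rV R n [set x | forall i, A i (x 0 i)] =
  (\prod_(i < n) lebesgue_measure (A i))%E.
Proof.
elim: n A => [|n IHn] A mA.
  rewrite big_ord0 /= diracE mem_set //=.
  by move=> [].
rewrite big_ord_recl -(IHn (fun i => A (lift ord0 i)))//.
rewrite /= /lebesgue_cons /pushforward.
pose B := [set x : 'rV[R]_n | forall i, A (lift ord0 i) (x 0 i)].
have mB : measurable B.
  rewrite (_ : B = \bigcap_(i in setT) ((fun x : 'rV[R]_n => x 0 i : measurableTypeR R) @^-1` A (lift ord0 i))).
    apply: fin_bigcap_measurable => // i _.
    by rewrite -[X in measurable X]setTI; apply: measurable_coord.
  by apply/seteqP; split => x /= h i; [move=> _|]; apply: h.
rewrite (_ : _ @^-1` _ = A ord0 `*` B); last first.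
  apply/seteqP; split => -[r v] /=; rewrite /rV_cons.
    move=> h; split; first by have := h ord0; rewrite mxE unlift_none.
    by move=> i; have := h (lift ord0 i); rewrite mxE liftK.
  move=> [Ar Bv] i; rewrite mxE.
  by case: unliftP => [j ->|->] //=; exact: Bv.
by rewrite product_measure2E.
Qed.

(* Functions on T^d = R^d / Z^d are represented by Z^d-periodic functions on
   R^d, subsets of T^d by Z^d-invariant subsets of R^d, and the integral over
   T^d by the integral over [0, 1)^d. *)
Definition periodic {R : realType} {d : nat} {T : Type} (f : 'rV[R]_d -> T) :=
  forall (x : 'rV[R]_d) (l : 'rV[int]_d), f (x + map_mx intr l) = f x.

Definition torus_invariant {R : realType} {d : nat} (U : set 'rV[R]_d) :=
  forall (x : 'rV[R]_d) (l : 'rV[int]_d), U x <-> U (x + map_mx intr l).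

Definition unit_cube (R : realType) (d : nat) : set 'rV[R]_d :=
  [set x | forall i, 0 <= x 0 i < 1].
Arguments unit_cube : clear implicits.

Section torus_continuous.
Context {R : realType} {d : nat}.

Definition torus_continuous : {pred 'rV[R]_d -> R} :=
  mem [set f : 'rV[R]_d -> R | continuous f /\ periodic f].

Lemma torus_continuous_submod_closed : submod_closed torus_continuous.
Proof.
split; first by rewrite inE; split => [|//]; exact: (@cst_continuous _ _ (0 : R)).
move=> a f g; rewrite !inE => -[cf pf] [cg pg]; split.
  move=> x; apply: (@continuousD _ _ _ (fun y => a * f y) g x) => //.
    by apply: continuousM; [exact: cst_continuous|exact: cf].
  exact: cg.
by move=> x l; rewrite !fctE pf pg.
Qed.

HB.instance Definition _ := GRing.isSubmodClosed.Build R ('rV[R]_d -> R)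
  torus_continuous torus_continuous_submod_closed.

End torus_continuous.

Record ctorus (R : realType) (d : nat) := CTorus {
  ctorus_fun :> 'rV[R]_d -> R ;
  ctorusP : ctorus_fun \in torus_continuous }.

Section ctorus_structures.
Context {R : realType} {d : nat}.

HB.instance Definition _ := [isSub of ctorus R d for @ctorus_fun R d].
HB.instance Definition _ := [Choice of ctorus R d by <:].
HB.instance Definition _ := [SubChoice_isSubLmodule of ctorus R d by <:].

Implicit Types f g : ctorus R d.

Lemma ctorus_continuous f : continuous f.
Proof. by have := ctorusP f; rewrite inE => -[]. Qed.

Lemma ctorus_periodic f : periodic f.
Proof. by have := ctorusP f; rewrite inE => -[]. Qed.

Lemma ctorus_bounded f : has_ubound [set `|f x| | x in [set: 'rV[R]_d]].
Proof.
pose K := [set v : 'rV[R]_d | forall i, `[0, 1]%classic (v ord0 i)].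
have cK : compact K.
  by apply: (@rV_compact R d (fun=> `[0, 1]%classic)) => i; exact: segment_compact.
have cf : {within K, continuous f}.
  by apply: continuous_subspaceT; exact: ctorus_continuous.
have [M [_ fM0]] := compact_bounded (continuous_compact cf cK).
have M1 : M < M + 1 by rewrite ltrDl.
have fM := fM0 _ M1; exists (M + 1) => _ [x _ <-].
pose l : 'rV[int]_d := \row_i (- Num.floor (x 0 i)).
rewrite -(ctorus_periodic f x l); apply: fM; exists (x + map_mx intr l) => //.
move=> i /=; rewrite in_itv/= !mxE intrN subr_ge0 floor_le /=.
by rewrite lerBlDl ltW// -intrD1 floorD1_gt.
Qed.

Definition ctorus_norm f : R := sup [set `|f x| | x in [set: 'rV[R]_d]].

Lemma ctorus_norm_ub f x : `|f x| <= ctorus_norm f.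
Proof. by apply: ub_le_sup; [exact: ctorus_bounded|exists x]. Qed.

Lemma ctorus_norm_le f M : (forall x, `|f x| <= M) -> ctorus_norm f <= M.
Proof.
move=> fM; apply: ge_sup; first by exists `|f 0|, 0.
by move=> _ [x _ <-].
Qed.

Let ler_ctorus_normD f g : ctorus_norm (f + g) <= ctorus_norm f + ctorus_norm g.
Proof.
apply: ctorus_norm_le => x; apply: (le_trans (ler_normD _ _)).
by apply: lerD; exact: ctorus_norm_ub.
Qed.

Let ctorus_normZ (a : R) f : ctorus_norm (a *: f) = `|a| * ctorus_norm f.
Proof.
apply/eqP; rewrite eq_le; apply/andP; split.
  apply: ctorus_norm_le => x; rewrite normrM.
  by rewrite ler_wpM2l// ctorus_norm_ub.
have [->|a0] := eqVneq a 0.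
  rewrite normr0 mul0r; apply: le_trans (ctorus_norm_ub _ 0); exact: normr_ge0.
rewrite mulrC -ler_pdivlMr ?normr_gt0//; apply: ctorus_norm_le => x.
rewrite ler_pdivlMr ?normr_gt0// mulrC -normrM.
exact: (ctorus_norm_ub (a *: f)).
Qed.

Let ctorus_norm0_eq0 f : ctorus_norm f = 0 -> f = 0.
Proof.
move=> f0; apply: val_inj; apply/funext => x; apply/eqP.
by rewrite -normr_le0 -f0; exact: ctorus_norm_ub.
Qed.

HB.instance Definition _ := Lmodule_isNormed.Build R (ctorus R d)
  ler_ctorus_normD ctorus_normZ ctorus_norm0_eq0.

Lemma ctorus_normE f : `|f| = sup [set `|f x| | x in [set: 'rV[R]_d]].
Proof. by []. Qed.

Let ctorus_complete (F : set_system (ctorus R d)) :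
  ProperFilter F -> cauchy F -> cvg F.
Proof.
move=> FF /cauchyP Fc.
have Fball (e : R) : 0 < e -> exists f, F [set h | `|f - h| < e].
  by move=> /Fc[f Ff]; exists f; move: Ff; rewrite -ball_normE.
pose ev (x : 'rV[R]_d) (f : ctorus R d) : R := f x.
have evB x (f h : ctorus R d) : `|f x - h x| <= `|f - h| by exact: (ctorus_norm_ub (f - h)).
have cev x : cvg (ev x @ F).
  apply/cauchy_cvgP/cauchyP => e e0; have [f Ff] := Fball e e0.
  exists (f x); suff : F [set h | ball (f x) e (ev x h)] by [].
  apply: filterS Ff => h /= fh; rewrite -ball_normE /=.
  exact: le_lt_trans (evB _ _ _) fh.
pose g x := lim (ev x @ F).
have gE (f : ctorus R d) (e : R) x : F [set h | `|f - h| < e] -> `|f x - g x| <= e.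
  move=> Ff; apply/ler_addgt0Pr => de de0.
  have /cvgrPdist_lt/(_ _ de0) Fg : ev x @ F --> g x by exact: cev.
  have [h [/= fh gh]] := filter_ex (filterI Ff Fg).
  rewrite -(subrK (h x) (f x)) -addrA (le_trans (ler_normD _ _))// lerD//.
    exact: le_trans (evB _ _ _) (ltW fh).
  by rewrite distrC ltW.
have cg : continuous g.
  move=> x; apply/(@cvgrPdist_lt _ _ _ (nbhs x) _ g) => e e0.
  have e40 : 0 < e / 4 by rewrite divr_gt0.
  have [f Ff] := Fball _ e40.
  have cfx : ctorus_fun f y @[y --> x] --> f x by exact: ctorus_continuous.
  have fx : \forall y \near x, `|f x - f y| < e / 4.
    by move/cvgrPdist_lt : cfx; exact.
  near=> y; have fxy : `|f x - f y| < e / 4 by near: y.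
  have := gE _ _ x Ff; have := gE _ _ y Ff.
  move: fxy; rewrite !(ltr_norml, ler_norml) => /andP[? ?] /andP[? ?] /andP[? ?].
  by apply/andP; split; lra.
have pg : periodic g.
  move=> x l; rewrite /g; congr (lim (_ @ F)); apply/funext => f.
  exact: ctorus_periodic.
have gP : g \in torus_continuous by rewrite inE.
apply/cvg_ex; exists (CTorus gP); apply/cvgrPdist_le => e e0.
have e20 : 0 < e / 2 by rewrite divr_gt0.
have [f Ff] := Fball _ e20.
apply: filterS (Ff) => h /= fh; apply: ctorus_norm_le => x.
rewrite -[leLHS]/(`|g x - h x|); have := gE _ _ x Ff.
have := le_lt_trans (evB x _ _) fh; rewrite ltr_norml !ler_norml => /andP[? ?] /andP[? ?].
by apply/andP; split; lra.
Unshelve. all: by end_near. Qed.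

HB.instance Definition _ := Uniform_isComplete.Build (ctorus R d)
  ctorus_complete.

End ctorus_structures.

Section prevalence.
Context {R : realType} {E : completeNormedModType R}.

Definition borel : set (set E) := <<s @open E >>.

(* A compact K is closed, hence Borel, and so are the translates of A. *)
Definition haar_null_borel (A : set E) :=
  borel A /\
  exists mu : probability (g_sigma_algebraType (@open E)) R,
    (exists2 K : set E, compact K & mu K = 1%E) /\
    forall x : E, mu [set x + a | a in A] = 0%E.

Definition haar_null (A : set E) := exists2 B, haar_null_borel B & A `<=` B.

Definition prevalent (A : set E) := haar_null (~` A).

End prevalence.

Section wavelets.
Context {R : realType} {d : nat}.
Local Notation mu := (lebesgue_rV R d).

Fixpoint partials (s : seq 'I_d) (f : 'rV[R]_d -> R) : 'rV[R]_d -> R :=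
  if s is i :: s' then fun x => 'D_(delta_mx 0 i) (partials s' f) x else f.

Definition has_partials (f : 'rV[R]_d -> R) :=
  forall (i : 'I_d) x, derivable f x (delta_mx 0 i).

Definition smooth (f : 'rV[R]_d -> R) :=
  forall s, continuous (partials s f) /\ has_partials (partials s f).

Definition fast_decay (f : 'rV[R]_d -> R) :=
  forall n : nat, exists C : R, forall x, `|f x| <= C / (1 + `|x|) ^+ n.

(* For r = 0 this is the fast decay of f alone, without any continuity. *)
Definition partials_fast_decay (r : nat) (f : 'rV[R]_d -> R) :=
  (forall s, (size s < r)%N -> has_partials (partials s f)) /\
  (forall s, (size s <= r)%N -> fast_decay (partials s f)).

Definition orthonormal_basis_L2 (I : eqType) (e : I -> 'rV[R]_d -> R) :=
  [/\ forall a, e a \in Lfun mu 2%:E,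
      forall a b, \int[mu]_x (e a x * e b x) = (a == b)%:R &
      forall g, g \in Lfun mu 2%:E -> forall eps : R, 0 < eps ->
        exists (s : seq I) (c : I -> R),
          (Lnorm mu 2%:E (fun x => (g x - \sum_(a <- s) c a * e a x)%:E)
            < eps%:E)%E].

Definition wavelet_system (phi : 'rV[R]_d -> R)
    (Psi : 'I_(2 ^ d - 1) -> 'rV[R]_d -> R)
    (a : 'rV[int]_d + 'I_(2 ^ d - 1) * nat * 'rV[int]_d) : 'rV[R]_d -> R :=
  match a with
  | inl k => fun x => phi (x - map_mx intr k)
  | inr (i, j, k) => fun x =>
      2 `^ ((d * j)%:R / 2) * Psi i (2 ^+ j *: x - map_mx intr k)
  end.

Definition orthonormal_wavelet_basis (r : nat) (phi : 'rV[R]_d -> R)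
    (Psi : 'I_(2 ^ d - 1) -> 'rV[R]_d -> R) :=
  [/\ partials_fast_decay r phi,
      forall i, partials_fast_decay r (Psi i) &
      orthonormal_basis_L2 (wavelet_system phi Psi)].

(* summability.sum is the limit along the finite subsets of Z^d, which exists
   here by absolute convergence. *)
Definition periodized_wavelet (Psi : 'I_(2 ^ d - 1) -> 'rV[R]_d -> R)
    (i : 'I_(2 ^ d - 1)) (j : nat) (k : 'rV[int]_d) (x : 'rV[R]_d) : R :=
  summability.sum (fun l : 'rV[int]_d =>
    Psi i (2 ^+ j *: (x - map_mx intr l) - map_mx intr k)).

Definition torus_integral (f : 'rV[R]_d -> R) : R :=
  \int[mu]_(x in unit_cube R d) f x.

Definition wavelet_coef (Psi : 'I_(2 ^ d - 1) -> 'rV[R]_d -> R)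
    (f : 'rV[R]_d -> R) (i : 'I_(2 ^ d - 1)) (j : nat) (k : 'rV[int]_d) : R :=
  2 ^+ (d * j) * torus_integral (fun x => f x * periodized_wavelet Psi i j k x).

(* The indices (j, (i, k)) of the periodized wavelets: 2^-j k \in [0, 1)^d
   means that each coordinate of k lies in {0, ..., 2^j - 1}. *)
Definition wavelet_index : Type :=
  {j : nat & ('I_(2 ^ d - 1) * 'rV['I_(2 ^ j)]_d)%type}.

Definition shift_of (j : nat) (k : 'rV['I_(2 ^ j)]_d) : 'rV[int]_d :=
  map_mx (fun m : 'I_(2 ^ j) => (m : nat)%:Z) k.

(* The closure of {theta != 0} is Z^d-invariant, and its image in T^d is compact
   as T^d is. *)
Definition test_function (U : set 'rV[R]_d) (theta : 'rV[R]_d -> R) :=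
  [/\ smooth theta, periodic theta & closure [set x | theta x != 0] `<=` U].

Definition torus_Linfty (U : set 'rV[R]_d) (g : 'rV[R]_d -> R) :=
  [/\ measurable_fun U g, periodic g &
      exists M : R, {ae mu, forall x, U x -> `|g x| <= M}].

Definition cvg_distributions (U : set 'rV[R]_d)
    (S : nat -> 'rV[R]_d -> R) (g : 'rV[R]_d -> R) :=
  forall theta, test_function U theta ->
    torus_integral (fun x => S J x * theta x) @[J --> \oo]
      --> torus_integral (fun x => g x * theta x).

(* S J stands for the partial sum over the scales j <= J. *)
Definition nowhere_locally_bounded (S : nat -> 'rV[R]_d -> R) :=
  ~ exists U : set 'rV[R]_d,
      [/\ open U, torus_invariant U, U !=set0 &
          exists2 g, torus_Linfty U g & cvg_distributions U S g].

End wavelets.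
Arguments wavelet_index : clear implicits.

Section random_series.
Context {R : realType} {d : measure_display} {Omega : measurableType d}.
Variable P : probability Omega R.

Definition unbounded_rv (chi : {RV P >-> R}) :=
  forall A : R, 0 < A -> (0 < P [set w | (A <= `|chi w|)%R])%E.

Definition independent_rvs (I : eqType) (X : I -> {RV P >-> R}) :=
  forall (s : seq I) (A : I -> set R), uniq s ->
    (forall a, measurable (A a)) ->
    P (\bigcap_(a in [set` s]) (X a @^-1` A a)) =
      (\prod_(a <- s) P (X a @^-1` A a))%E.

Definition iid_of_law (I : eqType) (X : I -> {RV P >-> R})
    (chi : {RV P >-> R}) :=
  independent_rvs X /\
  forall a (A : set R), measurable A ->
    distribution P (X a) A = distribution P chi A.

End random_series.

(* X_f, as the sequence of its partial sums over the scales j <= J. *)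
Definition randomized_series {R : realType} {d : nat}
    {dO : measure_display} {Omega : measurableType dO}
    {P : probability Omega R}
    (Psi : 'I_(2 ^ d - 1) -> 'rV[R]_d -> R)
    (X : wavelet_index d -> {RV P >-> R})
    (f : 'rV[R]_d -> R) (w : Omega) (J : nat) (x : 'rV[R]_d) : R :=
  \sum_(j < J.+1) \sum_(i < 2 ^ d - 1) \sum_(k : 'rV['I_(2 ^ j)]_d)
    wavelet_coef Psi f i j (shift_of k) * X (existT _ (j : nat) (i, k)) w *
    periodized_wavelet Psi i j (shift_of k) x.

(* Main.v *)
Require Import Defs.
From mathcomp Require Import finmap.
From mathcomp Require Import all_boot all_order all_algebra.
From mathcomp Require Import all_classical all_reals all_analysis.
From mathcomp Require Import measurable_realfun ring lra zify.
From mathcomp.analysis.showcase Require summability.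

Set Implicit Arguments.
Unset Strict Implicit.
Unset Printing Implicit Defensive.
Import Order.TTheory GRing.Theory Num.Theory.
Import numFieldNormedType.Exports.
Local Open Scope classical_set_scope.
Local Open Scope ring_scope.

(* Prevalence is tested along a line: a Borel set meeting every line of direction
   [g] in a Lebesgue null set is Haar-null, the measure being the law of [t g]
   for [t] uniform in [0, 1].

   Fix one wavelet [psi]. At a scale far finer than a given dyadic cube, pick
   indices in that cube so far apart that their periodized wavelets behave like
   bumps with disjoint supports. A signed sum of such wavelets is bounded,
   whatever their number, yet has all its coefficients bounded below. Summing
   such blocks along rapidly decreasing weights [eps n] gives a continuous [g]
   whose [n]th block of [2 h n] coefficients is bounded below by a multiple of
   [eps n]; each dyadic cube carries infinitely many blocks and the numbers [h n]
   are free. On every line of direction [g], by Markov's inequality and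
   Borel-Cantelli, for almost every point and all large [n] at least [h n]
   coefficients of the [n]th block exceed [2^-n eps n] up to a constant.

   If the randomized series is bounded on an open set, its pairings with smooth
   bumps [theta] sitting on the wavelets of a block are at most a constant times
   the integral of [theta]. Restricted to the large coefficients of the block,
   these pairings form a diagonally dominant system, which confines each of at
   least [h n] of the independent variables to an interval of fixed length,
   whatever the other variables are. As [chi] is unbounded it lies in such an
   interval with probability at most some [q < 1], uniformly in the position, and
   [h n] was chosen with [q ^ h n <= 1 / (n + 1)]. *)

(** * Small balls for unbounded variables *)

Section small_ball.
Context {R : realType} {dO : measure_display} {Omega : measurableType dO}.
Variable P : probability Omega R.

Lemma measurable_dist_le (Y : {RV P >-> R}) (r B : R) :
  measurable [set w | `|Y w - r| <= B].
Proof.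
rewrite (_ : [set _ | _] = Y @^-1` `[r - B, r + B]); first exact: measurable_sfunP.
by apply/seteqP; split => w /=; rewrite in_itv /= ler_distl.
Qed.

(** Fix [n] with [T n] of probability at most 1/2. If [|r| > n + |B|], the event lies in [T n];
    otherwise it misses [T (n + 2 |B| + 1)], whose probability [p] is positive. So the larger of
    [1 - p] and 1/2 serves for every [r]. *)
Lemma unbounded_anti_concentration (chi : {RV P >-> R}) (B : R) :
  unbounded_rv chi ->
  exists2 q : R, 0 <= q < 1 &
    forall r : R, (P [set w | (`|chi w - r| <= B)%R] <= q%:E)%E.
Proof.
move=> chiu; pose T (A : R) := [set w | A <= `|chi w|].
have mT A : measurable (T A).
  rewrite (_ : T A = (fun w => `|chi w|) @^-1` `[A, +oo[).
    have mf : measurable_fun setT (fun w => `|chi w|).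
      by apply: measurableT_comp => //; exact: measurable_funPT.
    by rewrite -[X in measurable X]setTI; apply: mf => //; exact: measurable_itv.
  by apply/seteqP; split => w /=; rewrite in_itv /= andbT.
have T0 : P \o (fun n : nat => T n%:R) @ \oo --> 0%E.
  have -> : 0%E = P (\bigcap_n T n%:R).
    rewrite (_ : \bigcap_n _ = set0) ?measure0// -subset0 => w wT.
    have := wT (Num.truncn `|chi w|).+1 I; rewrite /T/= leNgt => /negP; apply.
    exact: truncnS_gt.
  apply: nonincreasing_cvg_mu => //.
  - by rewrite (le_lt_trans (probability_le1 _ _))// ?ltry.
  - exact: bigcap_measurable.
  - move=> m n mn; apply/subsetPset => w /=; apply: le_trans.
    by rewrite ler_nat.
have [n Pn] : exists n : nat, (P (T n%:R) <= (2^-1)%:E)%E.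
  move/fine_cvgP : T0 => [_ /cvgrPdist_le /(_ 2^-1)].
  rewrite invr_gt0 ltr0n => /(_ isT)[n _ /(_ n (leqnn n))] /=.
  rewrite sub0r normrN => h; exists n.
  by rewrite -[leLHS]fineK ?fin_num_measure// lee_fin (le_trans (ler_norm _) h).
pose p := fine (P (T (n%:R + 2 * `|B| + 1))).
have pE : P (T (n%:R + 2 * `|B| + 1)) = p%:E by rewrite fineK ?fin_num_measure.
have p0 : 0 < p.
  have := chiu (n%:R + 2 * `|B| + 1); rewrite -/(T _) pE lte_fin; apply.
  have := normr_ge0 B; have := ler0n R n; lra.
have p1 : p <= 1 by rewrite -lee_fin -pE probability_le1.
exists (Num.max (1 - p) 2^-1).
  by rewrite le_max gt_max invr_ge0 ler0n orbT /=; apply/andP; split; lra.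
move=> r; rewrite EFin_max le_max.
have [rn|rn] := leP `|r| (n%:R + `|B|).
- apply/orP; left; rewrite EFinB -pE -probability_setC//.
  apply: le_measure; rewrite ?inE//; first exact: measurable_dist_le.
    exact: measurableC.
  move=> w /= h; rewrite /T /=; apply/negP; rewrite -ltNge.
  rewrite -[chi w](subrK r); apply: le_lt_trans (ler_normD _ _) _.
  have := ler_norm B; lra.
- apply/orP; right; apply: le_trans Pn.
  apply: le_measure; rewrite ?inE//; first exact: measurable_dist_le.
  move=> w /= h; rewrite /T /=.
  have := ler_norm B; have := ler_normD (r - chi w) (chi w).
  rewrite subrK distrC; lra.
Qed.

(* Freezing the variables outside [F] up to a small error leaves, for those of
   [F], a set of diameter at most [B] in each coordinate. The freezing is done
   by countably many cells, so that the product rule alone is enough. *)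
Lemma small_ball_system (I : eqType) (X : I -> {RV P >-> R}) (F G : seq I)
    (m : I -> I -> R) (mu : I -> R) (B q : R) :
  independent_rvs X -> uniq (F ++ G) -> 0 <= q ->
  (forall a r, a \in F -> P [set w | (`|X a w - r| <= B)%R] <= q%:E)%E ->
  (forall a, a \in F -> 0 < mu a) ->
  (forall v : I -> R,
    (forall a, a \in F -> `|\sum_(b <- F) m a b * v b| <= 4 * mu a) ->
    forall a, a \in F -> `|v a| <= B) ->
  (P [set w | forall a, a \in F ->
       (`|\sum_(b <- F ++ G) m a b * X b w| <= mu a)%R] <= (q ^+ size F)%:E)%E.
Proof.
move=> indX uFG q0 Xq mu0 mB; set E := [set _ | _].
have [uF /hasP FG uG] := and3P (etrans (esym (cat_uniq F G)) uFG).
have mE : measurable E.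
  have -> : E = \bigcap_(a in [set` F])
      (fun w => \sum_(b <- F ++ G) m a b * X b w) @^-1` `[- mu a, mu a].
    apply/seteqP; split => w /= h a aF /=; have := h a aF;
      by rewrite /= in_itv /= ler_norml.
  apply: fin_bigcap_measurable; first exact: finite_seq.
  move=> a _; rewrite -[X in measurable X]setTI.
  have mf : measurable_fun setT (fun w => \sum_(b <- F ++ G) m a b * X b w).
    apply: measurable_sum => b; apply: measurable_funM => //.
  exact: mf.
(* [eta] is the mesh of the cells: moving each variable of [G] by at most [eta] changes every form
   by at most [mu a]. *)
have [eta eta0 etaP] : exists2 eta : R, 0 < eta &
    forall a, a \in F -> eta * \sum_(b <- G) `|m a b| <= mu a.
  elim: (F) mu0 => [|a F' IH] mu0; first by exists 1.
  have [e e0 eP] := IH (fun b h => mu0 b (@mem_behead _ (a :: F') b h)).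
  have S0 b : 0 <= \sum_(c <- G) `|m b c| by apply: sumr_ge0.
  have ma := mu0 a (mem_head _ _).
  have S1 : 0 < \sum_(c <- G) `|m a c| + 1 by have := S0 a; lra.
  exists (Num.min e (mu a / (\sum_(c <- G) `|m a c| + 1))).
    by rewrite lt_min e0 divr_gt0.
  move=> b; rewrite inE => /predU1P[->|bF].
    apply: (@le_trans _ _ (mu a / (\sum_(c <- G) `|m a c| + 1) * \sum_(b <- G) `|m a b|)).
      by rewrite ler_wpM2r// ge_min lexx orbT.
    rewrite -mulrA; apply: ler_piMr; first exact: ltW.
    by rewrite mulrC ler_pdivrMr// mul1r; lra.
  by apply: le_trans (eP _ bF); rewrite ler_wpM2r// ge_min lexx.
(* A cell prescribes the integer parts of [X b / eta] for [b] in [G]; it is an event on the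
   variables of [G] alone. *)
pose A (z : (size G).-tuple int) b : set R :=
  [set x | Num.floor (x / eta) = nth 0 z (index b G)].
have mA z b : measurable (A z b).
  set k : int := nth 0 z (index b G).
  rewrite (_ : A z b = `[k%:~R * eta, (k + 1)%:~R * eta[%classic).
    exact: measurable_itv.
  apply/seteqP; split => x /=; rewrite in_itv /= -ler_pdivlMr// -ltr_pdivrMr//.
    by rewrite /A /= -/k => <-; rewrite floor_le floorD1_gt.
  by move=> /floor_def.
pose cell z := \bigcap_(b in [set` G]) (X b @^-1` A z b).
have mcell z : measurable (cell z).
  by apply: fin_bigcap_measurable => // b _; exact: measurable_funPTI.
(* [pickle] numbers the cells; a number that codes no tuple gets the empty set. *)
pose C n := if pickle_inv n is Some z then cell z else set0.
have mC n : measurable (C n) by rewrite /C; case: pickle_inv.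
pose Z w := map_tuple (fun b => Num.floor (X b w / eta)) (in_tuple G).
have cellZ z w : cell z w -> z = Z w.
  move=> zw; apply/val_inj/(@eq_from_nth _ 0).
    by rewrite size_tuple size_map.
  rewrite size_tuple => i iG.
  have [b0 _] : exists b : I, True by case: (G) iG => // b; exists b.
  rewrite (nth_map b0)//; have := zw _ (mem_nth b0 iG).
  by rewrite /A/= index_uniq.
have CE n w : C n w -> n = pickle (Z w).
  rewrite /C; have := (@pickle_invK ((size G).-tuple int) n); case: pickle_inv => //= z <-.
  by move=> /cellZ <-.
have Ccov w : C (pickle (Z w)) w.
  rewrite /C pickleK_inv => b bG; rewrite /A /= (nth_map b) ?index_mem//.
  by rewrite nth_index.
have tC : trivIset setT C.
  apply/trivIsetP => i j _ _ /eqP ij; rewrite -subset0 => w [/CE iE /CE jE]; by apply: ij; rewrite iE jE.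
(* Within a cell, compare with one point [w0] of the event. The forms restricted to [F] differ by at
   most [3 mu a], so [mB] confines each [X b], for [b] in [F], to the ball of radius [B] around the
   constant [X b w0]. Independence then gives one factor [q] for each [b]. *)
have PC n : (P (E `&` C n) <= (q ^+ size F)%:E * P (C n))%E.
  rewrite /C; case: pickle_inv => [z|]; last by rewrite setI0 measure0 mule0.
  have [->|/set0P[w0 [Ew0 cw0]]] := eqVneq (E `&` cell z) set0.
    by rewrite measure0 mule_ge0// lee_fin exprn_ge0.
  pose D b := if b \in F then [set x : R | `|x - X b w0| <= B] else A z b.
  have FD b : b \in F -> D b = [set x : R | `|x - X b w0| <= B] by rewrite /D => ->.
  have GD b : b \in G -> D b = A z b.
    by rewrite /D; case: ifPn => // bF bG; case: FG; exists b.
  have mD b : measurable (D b).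
    rewrite /D; case: ifP => // _.
    rewrite (_ : [set x | _] = `[X b w0 - B, X b w0 + B]%classic) //.
    by apply/seteqP; split => x; rewrite /= in_itv/= ler_distl.
  apply: (@le_trans _ _ (P (\bigcap_(b in [set` F ++ G]) (X b @^-1` D b)))).
    apply: le_measure; rewrite ?inE.
    - exact: measurableI.
    - by apply: fin_bigcap_measurable => // b _; exact: measurable_funPTI.
    move=> w [Ew cw] b /=; rewrite mem_cat => /orP[bF|bG]; last first.
      by rewrite /preimage /= GD//; exact: cw.
    rewrite /preimage /= FD//=; apply: (mB (fun b => X b w - X b w0)) => // a aF.
    have := Ew a aF; have := Ew0 a aF; rewrite !big_cat/=.
    set s0 := \sum_(b <- F) _; set t0 := \sum_(b <- G) _.
    set s1 := \sum_(b <- F) _; set t1 := \sum_(b <- G) _.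
    rewrite (_ : \sum_(b <- F) _ = s1 - s0); last first.
      by rewrite -sumrB; apply: eq_bigr => c _; rewrite mulrBr.
    have : `|t1 - t0| <= mu a.
      apply: le_trans (etaP a aF); rewrite -sumrB (le_trans (ler_norm_sum _ _ _))//.
      rewrite mulr_sumr big_seq [leRHS]big_seq; apply: ler_sum => c cG.
      rewrite -mulrBr normrM mulrC ler_wpM2r//.
      have /= := cw c cG; have /= := cw0 c cG; rewrite /A /= => z0 z1.
      have : `|X c w / eta - X c w0 / eta| <= 1.
        have := floor_le (X c w / eta); have := floorD1_gt (X c w / eta).
        have := floor_le (X c w0 / eta); have := floorD1_gt (X c w0 / eta).
        rewrite z0 z1 intrD ler_norml => *; apply/andP; split; lra.
      by rewrite -mulrBl normrM normfV (gtr0_norm eta0) ler_pdivrMr// mul1r.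
    rewrite !ler_norml => /andP[? ?] /andP[? ?] /andP[? ?]; apply/andP; split; lra.
  rewrite indX// big_cat /=; apply: lee_pmul.
  - by apply: prode_ge0.
  - by apply: prode_ge0.
  - have : {subset F <= F} by [].
    elim: {1 3 4}F => [|b s IH] sF; first by rewrite big_nil.
    rewrite big_cons /= exprS EFinM; apply: lee_pmul => //.
    + by apply: prode_ge0.
    + have bF := sF b (mem_head _ _); apply: le_trans (Xq b (X b w0) bF).
      by rewrite FD.
    + by apply: IH => c cs; apply: sF; rewrite inE cs orbT.
  - rewrite -indX//; apply: le_measure; rewrite ?inE//.
    + by apply: fin_bigcap_measurable => // b _; exact: measurable_funPTI.
    + by move=> w h b bG; have := h b bG; rewrite /preimage /= GD.
apply: (@le_trans _ _ (\sum_(n <oo) P (E `&` C n))%E).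
  apply: measure_sigma_subadditive => //.
  - by move=> n; exact: measurableI.
  - by move=> w Ew; exists (pickle (Z w)).
apply: (@le_trans _ _ (\sum_(n <oo) ((q ^+ size F)%:E * P (C n)))%E).
  by apply: lee_nneseries => // n _.
rewrite nneseriesZl// -measure_semi_bigcup//; last exact: bigcup_measurable.
rewrite -[leRHS]mule1 lee_wpmul2l ?lee_fin ?exprn_ge0// probability_le1//.
exact: bigcup_measurable.
Qed.
End small_ball.

(** * Sums over Z^d and periodized functions *)

Section family_sum.
Context {R : realType} {I : choiceType}.
Implicit Types (f : I -> R) (s : seq I).

Lemma partial_sumE f (A : {fset I}) :
  summability.partial_sum f A = \sum_(i <- A) f i.
Proof. exact: (esym (big_seq_fsetE _ A xpredT f)). Qed.

Lemma sum_fset_sub f (A0 A : {fset I}) : (A0 `<=` A)%fset ->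
  \sum_(i <- A) f i - \sum_(i <- A0) f i = \sum_(i <- (A `\` A0)%fset) f i.
Proof.
move=> sA; apply/eqP; rewrite subr_eq addrC; apply/eqP.
rewrite (big_fsetID _ (fun i => i \in A0)) /=; congr (_ + _).
  apply: eq_fbigl => i; rewrite !inE /=; apply/andP/idP => [[]//|iA0].
  by split => //; exact: (fsubsetP sA).
by apply: eq_fbigl => i; rewrite !inE /= andbC.
Qed.

(** Past a finite set whose absolute sum is within [e] of the supremum, the partial sums vary by
    less than [e], so they are Cauchy. *)
Lemma summable_cvg f (K : R) :
  (forall s, uniq s -> \sum_(i <- s) `|f i| <= K) ->
  cvg (summability.partial_sum f @ summability.totally).
Proof.
move=> fK; have FF := summability.totally_filter (I := I).
apply/cauchy_cvgP/cauchyP => e e0.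
pose V := [set \sum_(i <- A : {fset I}) `|f i| | A in setT].
have supV : has_sup V.
  split; first by exists (\sum_(i <- fset0) `|f i|), fset0.
  by exists K => _ [A _ <-]; apply: fK.
have [_ [A _ <-] AV] := sup_adherent e0 supV.
exists (summability.partial_sum f A).
exists A => //= B AB; rewrite -ball_normE /= distrC !partial_sumE sum_fset_sub//.
apply: le_lt_trans (ler_norm_sum _ _ _) _.
rewrite -(sum_fset_sub (fun i => `|f i|))//.
have : \sum_(i <- B) `|f i| <= sup V by apply: sup_upper_bound => //; exists B.
lra.
Qed.

Lemma sum_approx f (K : R) (s0 : seq I) (e : R) :
  (forall s, uniq s -> \sum_(i <- s) `|f i| <= K) -> uniq s0 ->
  (forall s, uniq s -> (forall i, i \in s -> i \notin s0) ->
     \sum_(i <- s) `|f i| <= e) ->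
  `|summability.sum f - \sum_(i <- s0) f i| <= e.
Proof.
move=> fK us0 fe; have FF := summability.totally_filter (I := I).
have /cvgrPdist_lt fc : summability.partial_sum f @ summability.totally -->
    (summability.sum f : R) by apply: summable_cvg fK.
apply/ler_addgt0Pr => de de0.
have [A _ AP] := fc _ de0.
pose A0 := [fset i in s0]%fset.
have A0E : \sum_(i <- A0) f i = \sum_(i <- s0) f i.
  apply: perm_big; apply: uniq_perm => // i.
  by rewrite inE.
have := AP (A `|` A0)%fset (fsubsetUl _ _); rewrite /= partial_sumE => h.
rewrite -A0E -(subrK (\sum_(i <- (A `|` A0)%fset) f i) (summability.sum f)).
rewrite -addrA (le_trans (ler_normD _ _))// [leRHS]addrC; apply: lerD; first exact: ltW.
rewrite sum_fset_sub ?fsubsetUr// (le_trans (ler_norm_sum _ _ _))//.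
by apply: fe => // i; rewrite !inE => /andP[].
Qed.

Lemma sum_bij f (h h' : I -> I) (K : R) : cancel h h' -> cancel h' h ->
  (forall s, uniq s -> \sum_(i <- s) `|f i| <= K) ->
  summability.sum (f \o h) = summability.sum f.
Proof.
move=> hK h'K fK; have FF := summability.totally_filter (I := I).
have fhK s : uniq s -> \sum_(i <- s) `|(f \o h) i| <= K.
  move=> us; rewrite -(big_map h xpredT (fun i => `|f i|)) fK// map_inj_uniq//.
  exact: can_inj hK.
have /cvgrPdist_lt fc : summability.partial_sum f @ summability.totally -->
    (summability.sum f : R) by apply: summable_cvg fK.
apply: cvg_lim => //; apply/cvgrPdist_lt => e e0; have [A _ AP] := fc _ e0.
exists [fset h' i | i in A]%fset => //= B AB.
have := AP [fset h i | i in B]%fset; rewrite /= !partial_sumE.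
rewrite (_ : \sum_(i <- [fset h i | i in B]%fset) f i = \sum_(i <- B) f (h i)).
  apply; apply/fsubsetP => i iA; apply/imfsetP; exists (h' i); rewrite ?h'K//=.
  by apply: (fsubsetP AB); apply/imfsetP; exists i.
rewrite -[RHS](big_map h xpredT f); apply: perm_big; apply: uniq_perm => //.
  by rewrite map_inj_uniq//; exact: can_inj hK.
by move=> i; apply/imfsetP/mapP => -[j /= jB ->]; exists j.
Qed.

End family_sum.

Lemma ler_coord_norm (R : realType) d (x : 'rV[R]_d) (i : 'I_d) :
  `|x 0 i| <= `|x|.
Proof.
rewrite /Num.norm /= mx_normrE.
exact: (le_bigmax _ (fun k : 'I_1 * 'I_d => `|x k.1 k.2|) (0, i)).
Qed.

Lemma rV_norm_le (R : realType) d (x : 'rV[R]_d) (r : R) : 0 <= r ->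
  (forall i, `|x 0 i| <= r) -> `|x| <= r.
Proof.
move=> r0 xr; rewrite /Num.norm /= mx_normrE; apply/bigmax_leP; split => //.
by move=> [k i] _ /=; rewrite (ord1 k).
Qed.

Section lattice_sum.
Context {R : realType}.

(* The terms are dominated by the increments of the bounded increasing function
   [y |-> y / (1 + |y|)], hence a bound independent of [u]. *)
Lemma lattice_sum1 (u : R) (n : nat) :
  \sum_(k < n) (1 + `|u + k%:R|) ^- 2 <= 4.
Proof.
pose phi (y : R) := y / (1 + `|y|).
have D0 (y : R) : 0 < 1 + `|y| by have := normr_ge0 y; lra.
have phi1 y : -1 <= phi y <= 1.
  rewrite -ler_norml /phi normrM normfV (gtr0_norm (D0 y)).
  by rewrite ler_pdivrMr// mul1r; lra.
have step y : (1 + `|y|) ^- 2 <= 2 * (phi (y + 1) - phi y).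
  have [y0|y0] := leP 0 y.
    rewrite /phi (ger0_norm y0) ger0_norm; last by lra.
    rewrite addrA (addrC 1 y).
    have -> : (y + 1) / (y + 1 + 1) - y / (y + 1) = ((y + 1) * (y + 2))^-1.
      by field; apply/andP; split; apply: lt0r_neq0; lra.
    rewrite -ler_pdivrMl// -invfM lef_pV2 ?posrE; nra.
  have [y1|y1] := leP y (-1).
    rewrite /phi (ltr0_norm y0) ler0_norm; last by lra.
    have y2 : 0 < y * (y - 1) by rewrite nmulr_rgt0; lra.
    have y3 : 0 < 2 * (1 - y) ^+ 2 by rewrite mulr_gt0 ?exprn_gt0; lra.
    have -> : (y + 1) / (1 - (y + 1)) - y / (1 - y) = (y * (y - 1))^-1.
      by field; repeat (apply/andP; split); apply/eqP => h; nra.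
    rewrite -ler_pdivrMl// -invfM lef_pV2 ?posrE //; nra.
  rewrite /phi (ltr0_norm y0) gtr0_norm; last by lra.
  have h1 : (y + 1) / 2 <= (y + 1) / (1 + (y + 1)).
    by rewrite ler_pM2l ?lef_pV2 ?posrE; lra.
  have h2 : - y / 2 <= - y / (1 - y).
    by rewrite ler_pM2l ?lef_pV2 ?posrE; lra.
  have h3 : (1 - y) ^- 2 <= 1.
    by rewrite invf_le1 ?exprn_gt0 ?exprn_ege1; lra.
  lra.
apply: (@le_trans _ _ (\sum_(k < n) 2 * (phi (u + k%:R + 1) - phi (u + k%:R)))).
  by apply: ler_sum => k _; exact: step.
rewrite -mulr_sumr.
have -> : \sum_(k < n) (phi (u + k%:R + 1) - phi (u + k%:R)) = phi (u + n%:R) - phi u.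
  elim: n => [|n IH]; first by rewrite big_ord0 addr0 subrr.
  by rewrite big_ord_recr /= IH -[n.+1%:R]natr1 [u + (_ + _)]addrA; lra.
have := phi1 u; have := phi1 (u + n%:R); lra.
Qed.

(** The norm dominates each coordinate, so [(1 + |v|)^(2d)] is at least the product of the
    [(1 + |v_i|)^2]. Over a box the sum of the inverse products factors into [d] one-dimensional
    sums, each at most 4. *)
Lemma lattice_sum_le d (u : 'rV[R]_d) (s : seq 'rV[int]_d) : uniq s ->
  \sum_(l <- s) (1 + `|u - map_mx intr l|) ^- (2 * d) <= 4 ^+ d.
Proof.
move=> us; have EX (x : R) : x ^+ d = \prod_(i < d) x by rewrite prodr_const card_ord.
have [B sB] : exists B : nat, forall l, l \in s -> forall i, (`|l 0%R i| <= B)%N.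
  exists (\max_(l <- s) \max_i `|l 0%R i|)%N => l ls i.
  by apply: leq_trans (leq_bigmax_seq _ ls isT); exact: (@leq_bigmax _ (fun i => `|l 0%R i|%N) i).
(* Shifting by [B] turns coordinates in [[-B, B]] into ordinals below [2B + 1]. *)
pose h (l : 'rV[int]_d) : {ffun 'I_d -> 'I_(2 * B).+1} :=
  [ffun i => inord `|(l 0%R i + B%:Z)%R|%N].
have hE l i : l \in s -> (h l i : nat)%:Z = l 0 i + B%:Z.
  move=> ls; have := sB _ ls i; rewrite ffunE; move: (l 0 i : int) => z zB.
  by rewrite inordK; lia.
pose w (g : {ffun 'I_d -> 'I_(2 * B).+1}) : R :=
  \prod_i (1 + `|u 0 i + B%:R - (g i)%:R|) ^- 2.
apply: (@le_trans _ _ (\sum_(l <- s) w (h l))).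
  rewrite big_seq [leRHS]big_seq; apply: ler_sum => l ls.
  have D1 (x : R) : 0 < 1 + `|x| by have := normr_ge0 x; lra.
  have D2 : 0 < 1 + `|u - map_mx intr l| by rewrite ltr_wpDr.
  rewrite /w prodfV lef_pV2 ?posrE ?prodr_gt0 ?exprn_gt0//.
  rewrite exprM EX; apply: ler_prod => i _.
  apply/andP; split; first by rewrite exprn_ge0// ltW.
  apply: lerXn2r; rewrite ?nnegrE ?(ltW D2) ?(ltW (D1 _))// lerD2l.
  rewrite -[(h l i)%:R]/((h l i)%:Z%:~R) hE// intrD opprD addrACA subrr addr0.
  by have := ler_coord_norm (u - map_mx intr l) i; rewrite !mxE.
rewrite -(big_map h xpredT w) big_uniq /=; last first.
  rewrite map_inj_in_uniq// => l l' ls l's hl; apply/rowP => i.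
  by have := hE _ i ls; rewrite hl hE// => /addIr.
apply: (@le_trans _ _ (\sum_g w g)).
  rewrite [leRHS](bigID [in [seq h i | i <- s]]) /= lerDl sumr_ge0// => g _.
  by apply: prodr_ge0 => i _; rewrite invr_ge0 exprn_ge0// addr_ge0.
rewrite /w -(bigA_distr_bigA (fun i (k : 'I_(2 * B).+1) => (1 + `|u 0 i + B%:R - k%:R|) ^- 2)).
rewrite EX; apply: ler_prod => i _.
apply/andP; split.
  by apply: sumr_ge0 => k _; rewrite invr_ge0 exprn_ge0// addr_ge0.
apply: le_trans (lattice_sum1 (- (u 0 i + B%:R)) (2 * B).+1).
by apply: ler_sum => k _; rewrite distrC [- _ + _]addrC.
Qed.

End lattice_sum.

Lemma lattice_box (R : realType) d (M : nat) : exists2 s : seq 'rV[int]_d,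
  uniq s & forall l, l \notin s -> M%:R < `|map_mx intr l : 'rV[R]_d|.
Proof.
pose e (g : {ffun 'I_d -> 'I_(2 * M).+1}) : 'rV[int]_d :=
  \row_i ((g i : nat)%:Z - M%:Z).
exists (undup (map e (enum {: {ffun 'I_d -> 'I_(2 * M).+1}}))).
  exact: undup_uniq.
move=> l; apply: contraR; rewrite -leNgt mem_undup => lM.
have lMi i : (`|l 0%R i| <= M)%N.
  have := le_trans (ler_coord_norm (map_mx intr l : 'rV[R]_d) i) lM.
  rewrite mxE -intr_norm -[M%:R]/(M%:Z%:~R) ler_int.
  by move: (l 0 i : int) => z; lia.
apply/mapP; exists [ffun i => inord `|(l 0%R i + M%:Z)%R|%N].
  by rewrite mem_enum.
apply/rowP => i; rewrite mxE ffunE; have := lMi i.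
by move: (l 0 i : int) => z zM; rewrite inordK; lia.
Qed.

(** Periodization of a single function; convertible with [periodized_wavelet Psi i] when [f] is
    [Psi i]. *)
Definition periodized {R : realType} {d : nat} (f : 'rV[R]_d -> R) (j : nat)
    (k : 'rV[int]_d) (x : 'rV[R]_d) : R :=
  summability.sum (fun l : 'rV[int]_d =>
    f (2 ^+ j *: (x - map_mx intr l) - map_mx intr k)).

Section periodized.
Context {R : realType} {d : nat} (f : 'rV[R]_d -> R).

(** A tail bound uniform in the scale, the shift and the point. The exponent [d + 1] leaves a spare
    power of [D] against the normalization [2^(dj)] of the coefficients. *)
Definition periodization_bound (C : R) := forall j k x (s : seq 'rV[int]_d) D,
  uniq s -> 0 < D ->
  (forall l, l \in s -> D <= 1 + `|2 ^+ j *: (x - map_mx intr l) - map_mx intr k|) ->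
  \sum_(l <- s) `|f (2 ^+ j *: (x - map_mx intr l) - map_mx intr k)|
    <= C / D ^+ d.+1.

(** Decay of order [2d + (d + 1)] is split: the factor of order [d + 1] gives the power of [D], and
    the factor of order [2d], compared with scale 0 through [2^j >= 1], is summed by
    [lattice_sum_le]. *)
Lemma fast_decay_periodization_bound : fast_decay f ->
  exists2 C, 1 <= C & periodization_bound C.
Proof.
move=> /(_ (2 * d + d.+1)%N)[C0 fC0].
exists (Num.max C0 1 * 4 ^+ d).
  by apply: mulr_ege1; rewrite ?le_max ?lexx ?orbT// exprn_ege1// ler1n.
move=> j k x s D us D0 sD; set C1 := Num.max C0 1.
have C10 : 0 <= C1 by rewrite le_max ler01 orbT.
pose u := x - 2 ^- j *: map_mx intr k.
have uE l : 2 ^+ j *: (x - map_mx intr l) - map_mx intr k =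
    2 ^+ j *: (u - map_mx intr l).
  rewrite /u !scalerBr scalerA divff ?scale1r ?expf_neq0//.
  by rewrite -!addrA [- _ - _ in LHS]addrC.
apply: (@le_trans _ _ (\sum_(l <- s)
    C1 / D ^+ d.+1 * (1 + `|u - map_mx intr l|) ^- (2 * d))); last first.
  rewrite -mulr_sumr [leRHS]mulrAC; apply: ler_wpM2l; last exact: lattice_sum_le.
  by rewrite divr_ge0 ?exprn_ge0// ltW.
rewrite big_seq [leRHS]big_seq; apply: ler_sum => l ls.
apply: le_trans (fC0 _) _; have := sD l ls; rewrite uE normrZ.
rewrite ger0_norm ?exprn_ge0//; set v := `|u - _| => Dv.
have v0 : 0 <= v by exact: normr_ge0.
have vv : v <= 2 ^+ j * v by rewrite ler_peMl// exprn_ege1// ler1n.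
have w0 : 0 < 1 + 2 ^+ j * v by rewrite ltr_wpDr// mulr_ge0// exprn_ge0.
have le_inv (a b : R) n : 0 < a -> a <= b -> b ^- n <= a ^- n.
  move=> a0 ab; have b0 := lt_le_trans a0 ab.
  by rewrite lef_pV2 ?posrE ?exprn_gt0//; apply: lerXn2r; rewrite ?nnegrE//= ltW.
have inv0 (a : R) n : 0 < a -> 0 <= a ^- n by move=> a0; rewrite invr_ge0 exprn_ge0// ltW.
apply: (@le_trans _ _ (C1 / (1 + 2 ^+ j * v) ^+ (2 * d + d.+1))).
  by apply: ler_wpM2r; [exact: inv0|rewrite le_max lexx].
rewrite exprD invfM -mulrA; apply: ler_wpM2l => //.
rewrite mulrC; apply: ler_pM; [exact: inv0|exact: inv0|exact: le_inv|].
by apply: le_inv; [rewrite ltr_wpDr|rewrite lerD2l].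
Qed.

Context (C : R).
Hypothesis fC : periodization_bound C.
Hypothesis C1 : 1 <= C.

Let w j k x (l : 'rV[int]_d) :=
  f (2 ^+ j *: (x - map_mx intr l) - map_mx intr k).

Lemma periodized_summable j k x (s : seq 'rV[int]_d) : uniq s ->
  \sum_(l <- s) `|w j k x l| <= C.
Proof.
move=> us; rewrite -[C]divr1 -(expr1n _ d.+1); apply: fC => // l _.
by rewrite lerDl.
Qed.

Lemma periodized_approx j k x (s : seq 'rV[int]_d) D : uniq s -> 0 < D ->
  (forall l, l \notin s -> D <= 1 + `|2 ^+ j *: (x - map_mx intr l) - map_mx intr k|) ->
  `|periodized f j k x - \sum_(l <- s) w j k x l| <= C / D ^+ d.+1.
Proof.
move=> us D0 sD; apply: (sum_approx (K := C)) => //.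
  by move=> t; exact: periodized_summable.
by move=> t ut tD; apply: fC => // l /tD; exact: sD.
Qed.

Lemma periodized_decay j k x D : 0 < D ->
  (forall l, D <= 1 + `|2 ^+ j *: (x - map_mx intr l) - map_mx intr k|) ->
  `|periodized f j k x| <= C / D ^+ d.+1.
Proof.
move=> D0 sD; rewrite -[periodized _ _ _ _]subr0.
by have := @periodized_approx j k x [::] D; rewrite big_nil; apply.
Qed.

Lemma periodized_le j k x : `|periodized f j k x| <= C.
Proof.
rewrite -[C]divr1 -(expr1n _ d.+1); apply: periodized_decay => // l.
by rewrite lerDl.
Qed.

Lemma periodized_periodic j k : Defs.periodic (periodized f j k).
Proof.
move=> x l0; have -> : periodized f j k x = summability.sum (w j k x) by [].
rewrite -(@sum_bij _ _ (w j k x) (fun l => l - l0) (fun l => l + l0) C).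
- congr summability.sum; apply/funext => l; rewrite /= /w map_mxB.
  by rewrite opprB addrA.
- exact: subrK.
- exact: addrK.
- by move=> s; exact: periodized_summable.
Qed.

(** Around [x0] one finite set of translates approximates the periodization uniformly, and a finite
    sum of translates is continuous. *)
Lemma periodized_continuous j k : continuous f -> continuous (periodized f j k).
Proof.
move=> cf x0; apply/(@cvgrPdist_le _ _ _ (nbhs x0) _ (periodized f j k)) => e e0.
(* [B] makes the tail [C / (1 + B)^(d+1)] at most [e / 4]. *)
pose B : R := (Num.truncn (4 * C / e)).+1%:R.
have BC : C / (1 + B) ^+ d.+1 <= e / 4.
  have B1 : 1 <= 1 + B by rewrite lerDl.
  have C0 : 0 < C by apply: lt_le_trans C1.
  rewrite ler_pdivrMr ?exprn_gt0//; last by lra.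
  rewrite -ler_pdivrMl ?divr_gt0// invf_div mulrC.
  apply: (@le_trans _ _ (1 + B)); last by rewrite -[leLHS]expr1 ler_weXn2l.
  apply: (@le_trans _ _ B); last by lra.
  by rewrite /B mulrCA mulrA ltW// truncnS_gt.
(* If [|l| > M] and [|x - x0| < 1], the argument of [f] has norm at least [B]. *)
pose M : nat := (Num.truncn (B + 2 ^+ j * (`|x0| + 1) + `|map_mx intr k : 'rV[R]_d|)).+1.
have [s us sM] := lattice_box R d M.
have sB x l : `|x0 - x| < 1 -> l \notin s ->
    1 + B <= 1 + `|2 ^+ j *: (x - map_mx intr l) - map_mx intr k|.
  move=> xx /sM lM; rewrite lerD2l.
  have x1 : `|x| <= `|x0| + 1.
    by rewrite -[x](subrK x0) (le_trans (ler_normD _ _))// addrC lerD2l distrC ltW.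
  have MB : B + 2 ^+ j * (`|x0| + 1) + `|map_mx intr k : 'rV[R]_d| <= M%:R.
    by rewrite ltW// truncnS_gt.
  have J1 : 1 <= 2 ^+ j :> R by rewrite exprn_ege1// ler1n.
  have J0 : 0 <= 2 ^+ j :> R by lra.
  have := lerB_normD (2 ^+ j *: (x - map_mx intr l)) (- map_mx intr k).
  have := lerB_normD (- map_mx intr l) x.
  rewrite !normrN [- map_mx intr l + x]addrC normrZ (ger0_norm J0).
  move: MB lM.
  set a := `|x - _|; set b := `|map_mx intr l|; set c := `|map_mx intr k|.
  move=> MB lM h1 h2; apply: le_trans h2.
  have := ler_wpM2l J0 h1; have := ler_wpM2l J0 x1.
  have : b <= 2 ^+ j * b by apply: ler_peMl => //; exact: normr_ge0.
  lra.
have cw l : continuous (fun x => w j k x l).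
  move=> x; have ca : {for x, continuous (fun x : 'rV[R]_d =>
      2 ^+ j *: (x - map_mx intr l) - map_mx intr k)}.
    apply: (@cvgB _ _ _ (nbhs x) _ (fun x => 2 ^+ j *: (x - map_mx intr l)));
      last exact: cvg_cst.
    apply: (@cvgZ _ _ _ (nbhs x) _ (fun=> 2 ^+ j)); first exact: cvg_cst.
    by apply: cvgB; [exact: cvg_id|exact: cvg_cst].
  exact: (continuous_comp ca (cf _)).
have cs : continuous (fun x => \sum_(l <- s) w j k x l).
  elim: (s) => [|l t IH].
    rewrite (_ : (fun _ => _) = fun=> 0); first exact: cst_continuous.
    by apply/funext => y; rewrite big_nil.
  rewrite (_ : (fun _ => _) = (w j k)^~ l \+ (fun x => \sum_(l <- t) w j k x l)).
    by move=> x; apply: continuousD; [exact: cw|exact: IH].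
  by apply/funext => y; rewrite big_cons.
have B1 : 0 < 1 + B by rewrite ltr_wpDr.
have /cvgrPdist_le/(_ (e / 2)) cs0 := cs x0.
have /cvgrPdist_lt/(_ 1 ltr01) nb : y @[y --> x0] --> x0 by exact: cvg_id.
near=> x.
have xx0 : `|x0 - x| < 1 by near: x; exact: nb.
have := periodized_approx us B1 (fun l => @sB x l xx0).
have := periodized_approx us B1 (fun l => @sB x0 l _).
rewrite subrr normr0 => /(_ ltr01) h0 h1.
have : `|\sum_(l <- s) w j k x0 l - \sum_(l <- s) w j k x l| <= e / 2.
  by near: x; apply: cs0; rewrite divr_gt0.
move: h0 h1 => /le_trans/(_ BC) + /le_trans/(_ BC).
rewrite !ler_norml => /andP[? ?] /andP[? ?] /andP[? ?]; apply/andP; split; lra.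
Unshelve. all: by end_near. Qed.

End periodized.

(** * Integration on the torus *)

Definition dyadic_cube (R : realType) (d D : nat) (z : 'rV[int]_d) :
    set 'rV[R]_d :=
  [set x | forall i, (z 0 i)%:~R <= 2 ^+ D * x 0 i <= (z 0 i + 1)%:~R].

Definition dyadic_index {R : realType} {d : nat} (D : nat) (x : 'rV[R]_d) :
    'rV[int]_d :=
  \row_i Num.floor (2 ^+ D * x 0 i).

Section borel_rV.
Context {R : realType} {d : nat}.

Lemma dyadic_cube_index D (x : 'rV[R]_d) :
  dyadic_cube D (dyadic_index D x) x.
Proof. by move=> i; rewrite mxE floor_le /= ltW// floorD1_gt. Qed.

Lemma measurable_dyadic_cube D z : measurable (@dyadic_cube R d D z).
Proof.
have -> : @dyadic_cube R d D z = \bigcap_(i in setT)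
    ((fun x : 'rV[R]_d => x 0 i : measurableTypeR R) @^-1`
      `[2 ^- D * (z 0 i)%:~R, 2 ^- D * (z 0 i + 1)%:~R]).
  have D0 : 0 < 2 ^+ D :> R by rewrite exprn_gt0.
  apply/seteqP; split => x h i /=.
    by move=> _; rewrite in_itv /= ler_pdivrMl// ler_pdivlMl// h.
  have := h i I; rewrite /= in_itv /=.
  by rewrite ler_pdivrMl// ler_pdivlMl//.
apply: fin_bigcap_measurable => // i _.
by rewrite -[X in measurable X]setTI; apply: measurable_coord.
Qed.

Lemma open_dyadic_cube (U : set 'rV[R]_d) (x : 'rV[R]_d) : open U -> U x ->
  exists D, dyadic_cube D (dyadic_index D x) `<=` U.
Proof.
move=> oU Ux; have /nbhs_ballP[e /= e0 eU] := open_nbhs_nbhs (conj oU Ux).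
exists (Num.truncn e^-1).+1 => y yx; apply: eU; rewrite -ball_normE /=.
set D := (Num.truncn e^-1).+1 in yx *.
have D0 : 0 < 2 ^+ D :> R by rewrite exprn_gt0.
have De : 2 ^- D < e.
  rewrite -[e]invrK ltf_pV2 ?posrE ?invr_gt0//.
  apply: lt_trans (truncnS_gt _) _.
  by rewrite -natrX ltr_nat ltn_expl.
apply: le_lt_trans De; apply: rV_norm_le => [|i]; first by rewrite invr_ge0 ltW.
rewrite -[2 ^- D]mul1r ler_pdivlMr// -{1}(gtr0_norm D0) -normrM !mxE mulrBl.
rewrite ler_norml ![_ * 2 ^+ D]mulrC.
have := yx i; have := dyadic_cube_index D x i.
by rewrite intrD => /andP[? ?] /andP[? ?]; apply/andP; split; lra.
Qed.

(** The sigma-algebra is generated by the coordinates; an open set is the countable union of the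
    dyadic cubes that it contains. *)
Lemma open_measurable_rV (U : set 'rV[R]_d) : open U -> measurable U.
Proof.
move=> oU.
have -> : U = \bigcup_(p : nat * 'rV[int]_d)
    (if pselect (@dyadic_cube R d p.1 p.2 `<=` U) then @dyadic_cube R d p.1 p.2 else set0).
  apply/seteqP; split => [x Ux|x [[D z] _]] /=; last by case: pselect => [DU /DU|//].
  have [D DU] := open_dyadic_cube oU Ux.
  exists (D, dyadic_index D x) => //=.
  by case: pselect => [?|/(_ DU)//]; exact: dyadic_cube_index.
apply: countable_bigcupT_measurable; first exact: countableP.
by move=> p; case: pselect => ?; [exact: measurable_dyadic_cube|exact: measurable0].
Qed.

Lemma continuous_measurable_rV (f : 'rV[R]_d -> R) : continuous f ->
  measurable_fun setT f.
Proof.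
move=> /continuousP cf; apply: (measurability (@RGenOInfty.G R)).
  exact: RGenOInfty.measurableE.
move=> _ [_ [a ->] <-]; rewrite setTI; apply: open_measurable_rV.
by apply: cf; exact: interval_open.
Qed.

Lemma measurable_unit_cube : measurable (unit_cube R d).
Proof.
have -> : unit_cube R d = \bigcap_(i in setT)
    ((fun x : 'rV[R]_d => x 0 i : measurableTypeR R) @^-1` `[0, 1[).
  apply/seteqP; split => x h i /=; first by move=> _; rewrite in_itv /=; exact: h.
  by have := h i I; rewrite /= in_itv.
apply: fin_bigcap_measurable => // i _.
by rewrite -[X in measurable X]setTI; apply: measurable_coord.
Qed.

Lemma lebesgue_unit_cube : lebesgue_rV R d (unit_cube R d) = 1%E.
Proof.
have -> : unit_cube R d = [set x | forall i, `[0, 1[%classic (x 0 i)].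
  by apply/seteqP; split => x h i; have := h i; rewrite /= in_itv.
rewrite (lebesgue_rV_box (A := fun=> `[0, 1[%classic))//.
apply: big1 => i _; rewrite lebesgue_measure_itv /= lte_fin ltr01 EFinN sube0//.
Qed.

Definition torus_integrable (f : 'rV[R]_d -> R) :=
  (lebesgue_rV R d).-integrable (unit_cube R d) (EFin \o f).

Lemma bounded_torus_integrable (f : 'rV[R]_d -> R) (C : R) :
  measurable_fun (unit_cube R d) f -> (forall x, `|f x| <= C) ->
  torus_integrable f.
Proof.
move=> mf fC; apply: measurable_bounded_integrable => //.
- exact: measurable_unit_cube.
- by rewrite lebesgue_unit_cube ltry.
- exists C; split; first exact: num_real.
  by move=> M CM x _; exact: le_trans (fC x) (ltW CM).
Qed.

Lemma continuous_torus_integrable (f : 'rV[R]_d -> R) (C : R) : continuous f ->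
  (forall x, `|f x| <= C) -> torus_integrable f.
Proof.
move=> cf; apply: bounded_torus_integrable.
exact: measurable_funTS (continuous_measurable_rV cf).
Qed.

Lemma torus_integralD f g : torus_integrable f -> torus_integrable g ->
  torus_integral (fun x => f x + g x) = torus_integral f + torus_integral g.
Proof. by apply: RintegralD; exact: measurable_unit_cube. Qed.

Lemma torus_integralZ r f : torus_integrable f ->
  torus_integral (fun x => r * f x) = r * torus_integral f.
Proof. by apply: RintegralZl; exact: measurable_unit_cube. Qed.

Lemma torus_integrableD f g : torus_integrable f -> torus_integrable g ->
  torus_integrable (fun x => f x + g x).
Proof.
move=> hf hg; rewrite /torus_integrable.
rewrite (_ : EFin \o _ = ((EFin \o f) \+ (EFin \o g))%E) //.
by apply: integrableD => //; exact: measurable_unit_cube.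
Qed.

Lemma torus_integrableZ r f : torus_integrable f ->
  torus_integrable (fun x => r * f x).
Proof.
move=> hf; rewrite /torus_integrable.
rewrite (_ : EFin \o _ = (fun x => r%:E * (EFin \o f) x)%E) //.
by apply: integrableZl => //; exact: measurable_unit_cube.
Qed.

Lemma torus_integral_sum (I : Type) (s : seq I) (f : I -> 'rV[R]_d -> R) :
  (forall i, torus_integrable (f i)) ->
  torus_integrable (fun x => \sum_(i <- s) f i x) /\
  torus_integral (fun x => \sum_(i <- s) f i x) =
    \sum_(i <- s) torus_integral (f i).
Proof.
move=> hf; elim: s => [|i s [IH1 IH2]].
  rewrite (_ : (fun _ => _) = fun=> 0); last first.
    by apply/funext => x; rewrite big_nil.
  rewrite big_nil; split; first exact: integrable0.
  by rewrite /torus_integral Rintegral_cst ?mul0r//; exact: measurable_unit_cube.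
rewrite (_ : (fun _ => _) = (fun x => f i x + \sum_(j <- s) f j x)); last first.
  by apply/funext => x; rewrite big_cons.
by split; [exact: torus_integrableD|rewrite torus_integralD// IH2 big_cons].
Qed.

Lemma le_torus_integral f g : torus_integrable f -> torus_integrable g ->
  (forall x, unit_cube R d x -> f x <= g x) ->
  torus_integral f <= torus_integral g.
Proof. by move=> hf hg; apply: le_Rintegral => //; exact: measurable_unit_cube. Qed.

Lemma torus_integral_cst (r : R) : torus_integral (fun _ : 'rV[R]_d => r) = r.
Proof.
rewrite /torus_integral Rintegral_cst ?lebesgue_unit_cube ?mulr1//.
exact: measurable_unit_cube.
Qed.

Lemma torus_integral_normr_le f g : torus_integrable f -> torus_integrable g ->
  (forall x, unit_cube R d x -> `|f x| <= g x) ->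
  `|torus_integral f| <= torus_integral g.
Proof.
move=> hf hg fg; rewrite ler_norml; apply/andP; split.
  rewrite -mulN1r -torus_integralZ//; apply: le_torus_integral => //.
    exact: torus_integrableZ.
  by move=> x /fg; rewrite mulN1r ler_norml => /andP[].
by apply: le_torus_integral => // x /fg; rewrite ler_norml => /andP[].
Qed.

End borel_rV.

(** * Smooth periodic bumps *)

Section smooth1.
Context {R : realType}.

(** Differentiability [n] times, with each derivative given by a witness: closure under sums,
    products and composition is then a plain induction on [n]. *)
Fixpoint ndiff (n : nat) (f : R -> R) : Prop :=
  if n is m.+1 then
    exists2 f', (forall x : R, is_derive x 1 f (f' x)) & ndiff m f'
  else True.

Definition smooth1 (f : R -> R) := forall n, ndiff n f.

Lemma ndiffS n f : ndiff n.+1 f -> ndiff n f.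
Proof.
by elim: n f => [//|n IH] f [f' df f'n]; exists f' => //; exact: IH.
Qed.

Lemma ndiffD n f g : ndiff n f -> ndiff n g -> ndiff n (fun x => f x + g x).
Proof.
elim: n f g => [//|n IH] f g [f' df nf] [g' dg ng].
by exists (fun x => f' x + g' x) => [x|]; [exact: is_deriveD|exact: IH].
Qed.

Lemma ndiffM n f g : ndiff n f -> ndiff n g -> ndiff n (fun x => f x * g x).
Proof.
elim: n f g => [//|n IH] f g fn gn.
have [f' df nf] := fn; have [g' dg ng] := gn.
exists (fun x => f x * g' x + g x * f' x).
  by move=> x; exact: is_deriveM.
by apply: ndiffD; apply: IH => //; exact: ndiffS.
Qed.

Lemma ndiff_comp n f g : ndiff n f -> ndiff n g -> ndiff n (fun x => f (g x)).
Proof.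
elim: n f g => [//|n IH] f g fn gn.
have [f' df nf] := fn; have [g' dg ng] := gn.
exists (fun x => f' (g x) * g' x).
  by move=> x; exact: is_derive1_comp.
by apply: ndiffM => //; apply: IH => //; exact: ndiffS.
Qed.

Lemma ndiff_cst n (c : R) : ndiff n (fun=> c).
Proof.
by elim: n c => [//|n IH] c; exists (fun=> 0) => // x; exact: is_derive_cst.
Qed.

Lemma ndiffZ n (c : R) f : ndiff n f -> ndiff n (fun x => c * f x).
Proof. exact: (ndiffM (ndiff_cst n c)). Qed.

Lemma ndiff_affine n (a b : R) : ndiff n (fun x => a * x + b).
Proof.
case: n => [//|n]; exists (fun=> a); last exact: ndiff_cst.
by move=> x; apply: is_derive_eq; rewrite /= addr0 [_%:A]mulr1.
Qed.

Lemma ndiff_cos n : ndiff n (@cos R).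
Proof.
suff : ndiff n (@cos R) /\ ndiff n (@sin R) by case.
elim: n => [//|n [IHc IHs]]; split.
  exists (fun x => - sin x) => [x|]; first exact: is_derive_cos.
  rewrite (_ : (fun _ => _) = (fun x => -1 * sin x)); first exact: ndiffZ.
  by apply/funext => x; rewrite mulN1r.
by exists (@cos R) => // x; exact: is_derive_sin.
Qed.

(* The functions [t^-n exp(-1/t)] span a space closed under derivation. *)
Definition flat (n : nat) (t : R) : R :=
  if 0 < t then t^-1 ^+ n * expR (- t^-1) else 0.

(** Comes from [expR u >= u^(n+2) / (n+2)!] at [u = 1/t]. The square serves twice: it makes [flat n]
    differentiable at 0, and it bounds the bumps by 8. *)
Lemma flat_bound n (t : R) : 0 <= flat n t <= n.+2`!%:R * t ^+ 2.
Proof.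
rewrite /flat; case: ifPn => [t0|_]; last by rewrite lexx mulr_ge0 // sqr_ge0.
have ti0 : 0 < t^-1 by rewrite invr_gt0.
rewrite mulr_ge0 ?expR_ge0 ?exprn_ge0 ?(ltW ti0)//=.
have F0 : 0 < n.+2`!%:R :> R by rewrite ltr0n fact_gt0.
have := expR_ge1Dxn n.+1 (ltW ti0).
rewrite expRN ler_pdivrMr ?expR_gt0// => h.
have {}h : t^-1 ^+ n.+2 / n.+2`!%:R <= expR t^-1.
  by apply: le_trans h; rewrite lerDr.
have -> : t^-1 ^+ n = t ^+ 2 * (t^-1 ^+ n.+2).
  by rewrite -[n.+2]addn2 exprD mulrCA -exprMn divff ?gt_eqF// expr1n mulr1.
rewrite [leRHS]mulrAC [leRHS]mulrC; apply: ler_wpM2l; first exact: sqr_ge0.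
by rewrite mulrC -ler_pdivrMr.
Qed.

Lemma is_derive_flat n (t : R) :
  is_derive t 1 (flat n) (- n%:R * flat n.+1 t + flat n.+2 t).
Proof.
have [t0|t0|->] := ltgtP t 0.
- rewrite /flat [0 < t]ltNge (ltW t0) /= mulr0 addr0.
  apply: (@near_eq_is_derive _ _ _ (cst 0)).
    near=> u; have u0 : u < 0 by near: u; exact: lt_nbhsl.
    by rewrite ltNge (ltW u0).
- rewrite /flat t0.
  apply: (@near_eq_is_derive _ _ _ (fun u : R => u^-1 ^+ n * expR (- u^-1))).
    near=> u; have u0 : 0 < u by near: u; exact: lt_nbhsr.
    by rewrite u0.
  have tn0 : t != 0 by rewrite gt_eqF.
  have dV := is_deriveV tn0 (is_derive_id t (1 : R)).
  have dX := is_deriveX n dV.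
  have dE := @is_derive1_comp _ expR (fun u => - u^-1) t _ _ (is_derive_expR _) (is_deriveN dV).
  rewrite (_ : (fun _ => _) = GRing.inv ^+ n * (expR \o (fun u : R => - u^-1))); last first.
    by apply/funext => u; rewrite /GRing.mul /= exprfctE.
  apply: (is_derive_eq (is_deriveM dX dE)).
  rewrite /GRing.scale /= exprfctE !mulr1 -!exprVn.
  by case: (n) => [|m]; rewrite ?expr0 /= !exprS; ring.
(* At 0 the difference quotient is [flat n h / h], of modulus at most [(n+2)! |h|]. *)
- rewrite /flat ltxx mulr0 addr0.
  have c0 : (fun h => h^-1 *: ((flat n \o shift 0) (h *: 1) - flat n 0))
      @ (0 : R)^' --> (0 : R).
    apply/cvgrPdist_le => e e0.
    have F0 : 0 < n.+2`!%:R :> R by rewrite ltr0n fact_gt0.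
    near=> h.
    have h0 : h != 0 by near: h; exact: nbhs_dnbhs_neq.
    have he : `|h| <= e / n.+2`!%:R.
      near: h; apply: dnbhs0_le; exact: divr_gt0.
    have /andP[f0 f1] := flat_bound n h.
    rewrite sub0r normrN /= addr0 [_%:A]mulr1 {2}/flat ltxx subr0.
    rewrite normrM normfV (ger0_norm f0) mulrC ler_pdivrMr ?normr_gt0//.
    apply: le_trans f1 _; rewrite -(real_normK (num_real h)) expr2 mulrA.
    apply: ler_wpM2r => //; by rewrite mulrC -ler_pdivlMr.
  apply: DeriveDef; first exact: (cvgP _ c0).
  exact: cvg_lim c0.
Unshelve. all: by end_near. Qed.

Lemma ndiff_flat m n : ndiff m (flat n).
Proof.
elim: m n => [//|m IH] n.
exists (fun t => - n%:R * flat n.+1 t + flat n.+2 t); first exact: is_derive_flat.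
by apply: ndiffD => //; exact: ndiffZ.
Qed.

(* The cosines make the bump 1-periodic: it is positive at distance less than [r]
   from [c + Z] and zero elsewhere. *)
Definition bump1 (r c x : R) : R :=
  flat 0 (cos (2 * pi * x - 2 * pi * c) - cos (2 * pi * r)).

Lemma smooth_bump1 r c : smooth1 (bump1 r c).
Proof.
move=> n; apply: (@ndiff_comp n (flat 0)); first exact: ndiff_flat.
apply: ndiffD; last exact: ndiff_cst.
by apply: (ndiff_comp (ndiff_cos n)); exact: ndiff_affine.
Qed.

Lemma cos_int_period (x : R) (z : int) : cos (x + 2 * pi * z%:~R) = cos x.
Proof.
have cosn n y : cos (y + 2 * pi * n%:R) = cos y :> R.
  rewrite -[RHS](periodicn (@cosD2pi R) n); congr (cos (_ + _)).
  by rewrite -[RHS]mulr_natr -mulr_natl; ring.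
case: z => n; first exact: cosn.
by rewrite NegzE -[LHS](cosn n.+1) intrN mulrN subrK.
Qed.

Lemma bump1_periodic r c (x : R) (z : int) : bump1 r c (x + z%:~R) = bump1 r c x.
Proof.
rewrite /bump1 -[in RHS](cos_int_period _ z); congr (flat 0 (cos _ - _)); ring.
Qed.

Lemma bump1_ge0 r c x : 0 <= bump1 r c x.
Proof. by have /andP[] := flat_bound 0 (cos (2 * pi * x - 2 * pi * c) - cos (2 * pi * r)). Qed.

Lemma bump1_le r c x : bump1 r c x <= 8.
Proof.
have /andP[_] := flat_bound 0 (cos (2 * pi * x - 2 * pi * c) - cos (2 * pi * r)).
move=> h; apply: le_trans h _.
have := cos_le1 (2 * pi * x - 2 * pi * c); have := cos_geN1 (2 * pi * x - 2 * pi * c).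
have := cos_le1 (2 * pi * r); have := cos_geN1 (2 * pi * r).
set a := cos _; set b := cos _ => *.
by rewrite (_ : 2`!%:R = 2) //; nra.
Qed.

(** Up to sign, [z] is an integer nearest to [y]; then [2 pi |y + z|] lies in [[0, pi]], where the
    cosine is strictly decreasing. *)
Lemma cos_near_int r (y : R) : 0 <= r <= 2^-1 -> cos (2 * pi * r) <= cos (2 * pi * y) ->
  exists z : int, `|y + z%:~R| <= r.
Proof.
move=> r01 rc; exists (- Num.floor (y + 2^-1)).
set z := Num.floor _; have pi0 := pi_gt0 R.
have z1 : `|y - z%:~R| <= 2^-1.
  have := floor_le (y + 2^-1); have := floorD1_gt (y + 2^-1); rewrite -/z intrD.
  by rewrite ler_norml => *; apply/andP; split; lra.
rewrite intrN; move: rc.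
rewrite -(cos_int_period (2 * pi * y) (- z)) -mulrDr intrN -[in X in _ <= X]cos_norm.
rewrite normrM (gtr0_norm (mulr_gt0 (ltr0Sn R 1) pi0)) => rc.
rewrite leNgt; apply/negP => ry.
move: rc; rewrite leNgt ltr_cos ?in_itv /=; first by rewrite ltr_pM2l ?ry// mulr_gt0.
- by apply/andP; split; nra.
- by apply/andP; split; nra.
Qed.

Lemma bump1_gt0 r c : 0 < r <= 2^-1 -> 0 < bump1 r c c.
Proof.
move=> /andP[r0 r1]; rewrite /bump1 /flat subrr cos0 expr0 mul1r.
have pi0 := pi_gt0 R.
suff -> : 0 < 1 - cos (2 * pi * r) :> R by exact: expR_gt0.
rewrite subr_gt0 -[ltRHS](@cos0 R) ltr_cos ?in_itv /= ?lexx ?pi_ge0//.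
  by rewrite !mulr_gt0.
by apply/andP; split; nra.
Qed.

Lemma bump1_neq0 r c x : bump1 r c x != 0 ->
  cos (2 * pi * r) < cos (2 * pi * (x - c)).
Proof.
by rewrite /bump1 /flat subr_gt0 mulrBr; case: ifP => //; rewrite eqxx.
Qed.

End smooth1.

Section tensor.
Context {R : realType} {d : nat}.

(** Reduces partial derivatives to derivatives of functions of one variable. *)
Lemma is_derive_line (f : 'rV[R]_d -> R) (x v : 'rV[R]_d) (df : R) :
  is_derive (0 : R) 1 (fun h => f (h *: v + x)) df -> is_derive x v f df.
Proof.
move=> [fd fE]; have dfx : derivable f x v := (derivable1P f x v).2 fd.
apply: DeriveDef => //.
rewrite -fE /derive; set g1 := fun h => h^-1 *: _; set g2 := fun h => h^-1 *: _.
suff -> : g1 = g2 by [].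
by rewrite funeqE /g1 /g2 => h /=; rewrite addr0 scale0r add0r [_%:A]mulr1.
Qed.

Lemma smooth1_derive (f : R -> R) : smooth1 f ->
  smooth1 (f^`())%classic /\ forall x : R, is_derive x 1 f (f^`()%classic x).
Proof.
move=> fs; split => [n|x].
  have [f' df nf] := fs n.+1; rewrite (_ : f^`()%classic = f')//.
  by apply/funext => x; rewrite derive1E derive_val.
by have [f' df _] := fs 1%N; rewrite derive1E derive_val.
Qed.

Lemma smooth1_continuous (f : R -> R) : smooth1 f -> continuous f.
Proof.
move=> /(_ 1%N)[f' df _] x; apply: differentiable_continuous.
by apply/derivable1_diffP; have [] := df x.
Qed.

Definition tensor (b : 'I_d -> R -> R) (x : 'rV[R]_d) : R := \prod_j b j (x 0 j).

Lemma is_derive_tensor (b : 'I_d -> R -> R) (i : 'I_d) (x : 'rV[R]_d) :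
  (forall j, smooth1 (b j)) ->
  is_derive x (delta_mx 0 i) (tensor b)
    (tensor (fun j => if j == i then (b j)^`()%classic else b j) x).
Proof.
move=> bs; apply: is_derive_line; rewrite /tensor.
pose c := \prod_(j | j != i) b j (x 0 j).
rewrite (_ : (fun _ => _) = (fun h => c * b i (h + x 0 i))); last first.
  apply/funext => h; rewrite (bigD1 i)//= !mxE !eqxx /= mulr1 mulrC; congr (_ * _).
  by apply: eq_bigr => j ji; rewrite !mxE eqxx /= (negbTE ji) mulr0 add0r.
rewrite (bigD1 i)//= eqxx mulrC (_ : \prod_(j | _) _ = c); last first.
  by apply: eq_bigr => j /negbTE ->.
have [_ db] := smooth1_derive (bs i).
have ds : is_derive (0 : R) 1 (fun h => h + x 0 i) 1.
  by apply: is_derive_eq; rewrite addr0.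
have db0 : is_derive (0 + x 0 i) 1 (b i) ((b i)^`()%classic (x 0 i)).
  by rewrite add0r.
have := @is_derive1_comp _ (b i) (fun h => h + x 0 i) 0 _ _ db0 ds.
by rewrite mulr1 => h; exact: is_deriveZ.
Qed.

Lemma continuous_tensor (b : 'I_d -> R -> R) : (forall j, continuous (b j)) ->
  continuous (tensor b).
Proof.
move=> bs; rewrite /tensor; elim: (index_enum _) => [|j s IH].
  rewrite (_ : (fun _ => _) = fun=> 1); first exact: cst_continuous.
  by apply/funext => y; rewrite big_nil.
rewrite (_ : (fun _ => _) = fun x : 'rV[R]_d => b j (x 0 j) * \prod_(k <- s) b k (x 0 k)).
  move=> x; apply: continuousM; last exact: IH.
  by apply: (continuous_comp (@coord_continuous _ _ _ 0 j x) (bs j _)).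
by apply/funext => y; rewrite big_cons.
Qed.

(** Tensor products of smooth functions are stable under partial derivatives: deriving along [i]
    only replaces the [i]th factor by its derivative. *)
Lemma smooth_tensor (b : 'I_d -> R -> R) : (forall j, smooth1 (b j)) ->
  smooth (tensor b).
Proof.
move=> bs s.
have [b' b's ->] : exists2 b', forall j, smooth1 (b' j) & partials s (tensor b) = tensor b'.
  elim: s => [|i s [b' b's IH]]; first by exists b.
  exists (fun j => if j == i then (b' j)^`()%classic else b' j).
    by move=> j; case: ifP => // _; exact: (smooth1_derive (b's j)).1.
  apply/funext => x /=; rewrite IH.
  by have ? := is_derive_tensor i x b's; rewrite derive_val.
split; first by apply: continuous_tensor => j; exact: smooth1_continuous.
by move=> i x; have [] := is_derive_tensor i x b's.
Qed.

Lemma box_torus_integral (f : 'rV[R]_d -> R) (c : 'rV[R]_d) (r m : R) :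
  torus_integrable f -> 0 <= m -> 0 < r ->
  (forall x : 'rV[R]_d, (forall i, `|x 0 i - c 0 i| < r) -> unit_cube R d x /\ m <= f x) ->
  (forall x, unit_cube R d x -> 0 <= f x) ->
  m * (2 * r) ^+ d <= torus_integral f.
Proof.
move=> fi m0 r0 fm f0.
pose B := [set x : 'rV[R]_d | forall i, `]c 0 i - r, c 0 i + r[%classic (x 0 i)].
have BE x : B x <-> forall i, `|x 0 i - c 0 i| < r.
  by split => h i; have := h i; rewrite /= in_itv /= ltr_distl.
have mB : measurable B.
  have -> : B = \bigcap_(i in setT)
      ((fun x : 'rV[R]_d => x 0 i : measurableTypeR R) @^-1` `]c 0 i - r, c 0 i + r[).
    by apply/seteqP; split => x h i; [move=> _; exact: h|exact: h].
  apply: fin_bigcap_measurable => // i _.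
  by rewrite -[X in measurable X]setTI; apply: measurable_coord.
have muB : lebesgue_rV R d B = ((2 * r) ^+ d)%:E.
  rewrite (lebesgue_rV_box (A := fun i => `]c 0 i - r, c 0 i + r[%classic))//.
  rewrite (eq_bigr (fun=> (2 * r)%:E)).
    by rewrite prodEFin prodr_const card_ord.
  move=> i _; rewrite lebesgue_measure_itv /= lte_fin ifT; last by lra.
  by rewrite -EFinB; congr EFin; ring.
pose g x := m * \1_B x : R.
have mg : measurable_fun setT g.
  by apply: measurable_funM => //; exact: measurable_indic.
have gi : torus_integrable g.
  apply: (@bounded_torus_integrable _ _ _ m); first exact: measurable_funTS.
  move=> x; rewrite /g indicE normrM (ger0_norm m0) ler_piMr//.
  by case: (x \in B); rewrite ?normr1 ?normr0.
have -> : m * (2 * r) ^+ d = torus_integral g.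
  rewrite /g torus_integralZ; last first.
    apply: (@bounded_torus_integrable _ _ _ 1).
      by apply: measurable_funTS; exact: measurable_indic.
    by move=> x; rewrite indicE; case: (x \in B); rewrite ?normr1 ?normr0.
  congr (_ * _); rewrite /torus_integral /Rintegral integral_indic//; last exact: measurable_unit_cube.
  rewrite (_ : B `&` _ = B) ?muB//.
  by apply/setIidl => x /BE/fm[].
apply: le_torus_integral => // x xU; rewrite /g indicE.
have [|xB] := boolP (x \in B); last by rewrite mulr0 f0.
by rewrite inE => /BE/fm[_]; rewrite mulr1.
Qed.

Definition torus_bump (r : R) (c : 'rV[R]_d) : 'rV[R]_d -> R :=
  tensor (fun i => bump1 r (c 0 i)).

Lemma smooth_torus_bump r c : smooth (torus_bump r c).
Proof. by apply: smooth_tensor => j; exact: smooth_bump1. Qed.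

Lemma continuous_torus_bump r c : continuous (torus_bump r c).
Proof. by apply: continuous_tensor => j; apply: smooth1_continuous; exact: smooth_bump1. Qed.

Lemma torus_bump_periodic r c : Defs.periodic (torus_bump r c).
Proof.
move=> x l; apply: eq_bigr => i _; rewrite !mxE; exact: bump1_periodic.
Qed.

Lemma torus_bump_ge0 r c x : 0 <= torus_bump r c x.
Proof. by apply: prodr_ge0 => i _; exact: bump1_ge0. Qed.

Lemma torus_bump_norm_le r c x : `|torus_bump r c x| <= 8 ^+ d.
Proof.
rewrite ger0_norm ?torus_bump_ge0// -[d in leRHS]card_ord -prodr_const.
by apply: ler_prod => i _; rewrite bump1_ge0 bump1_le.
Qed.

Lemma torus_bump_integrable r c : torus_integrable (torus_bump r c).
Proof.
apply: (@continuous_torus_integrable _ _ _ (8 ^+ d)).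
  exact: continuous_torus_bump.
exact: torus_bump_norm_le.
Qed.

(** Where the bump does not vanish, [cos (2 pi r) < cos (2 pi (x_i - c_i))] for all [i]. The large
    inequality is a closed condition, so it passes to the closure, and [cos_near_int] reads it as a
    distance modulo Z. *)
Lemma closure_torus_bump r c x : 0 <= r <= 2^-1 ->
  closure [set x | torus_bump r c x != 0] x ->
  exists l : 'rV[int]_d, forall i, `|(x + map_mx intr l) 0 i - c 0 i| <= r.
Proof.
move=> r01.
pose F := \bigcap_(i in [set: 'I_d])
  [set y : 'rV[R]_d | cos (2 * pi * r) <= cos (2 * pi * (y 0 i - c 0 i))].
have cF : closed F.
  apply: closed_bigI => i _.
  have ci : continuous (fun y : 'rV[R]_d => cos (2 * pi * (y 0 i - c 0 i))).
    move=> y; apply: (@continuous_comp _ _ _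
      (fun y : 'rV[R]_d => 2 * pi * (y 0 i - c 0 i)) (@cos R)); last exact: continuous_cos.
    apply: continuousM; first exact: cst_continuous.
    apply: continuousB; last exact: cst_continuous.
    exact: coord_continuous.
  exact: (closed_comp (D := [set t : R | cos (2 * pi * r) <= t]) (fun y _ => ci y) (@closed_ge R _)).
have sF : [set x | torus_bump r c x != 0] `<=` F.
  move=> y /= yn0 i _ /=; apply/ltW/bump1_neq0.
  by apply: contraNneq yn0 => y0; rewrite /torus_bump /tensor (bigD1 i)//= y0 mul0r.
move=> /(closureS sF); rewrite -(closure_id F).1// => xF.
have /choice[l lP] : forall i, exists z : int, `|x 0 i - c 0 i + z%:~R| <= r.
  by move=> i; apply: cos_near_int => //; exact: (xF i I).
by exists (\row_i l i) => i; rewrite !mxE addrAC.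
Qed.

Lemma torus_bump_test (r : R) (c : 'rV[R]_d) (U : set 'rV[R]_d) : 0 <= r <= 2^-1 ->
  torus_invariant U ->
  (forall x : 'rV[R]_d, (forall i, `|x 0 i - c 0 i| <= r) -> U x) ->
  test_function U (torus_bump r c).
Proof.
move=> r01 iU rU; split; [exact: smooth_torus_bump|exact: torus_bump_periodic|].
by move=> x /(closure_torus_bump r01)[l xl]; apply/(iU x l); exact: rU.
Qed.

Lemma torus_bump_integral_gt0 (r : R) (c : 'rV[R]_d) : 0 < r <= 2^-1 ->
  (forall x : 'rV[R]_d, (forall i, `|x 0 i - c 0 i| < r) -> unit_cube R d x) ->
  0 < torus_integral (torus_bump r c).
Proof.
move=> r01 rU; have [r0 _] := andP r01.
have b0 : 0 < torus_bump r c c by apply: prodr_gt0 => i _; exact: bump1_gt0.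
have b20 : 0 < torus_bump r c c / 2 by rewrite divr_gt0.
have /cvgrPdist_lt/(_ _ b20)/nbhs_ballP[e /= e0 eb] := @continuous_torus_bump r c c.
have er0 : 0 < Num.min (e / 2) r by rewrite lt_min r0 andbT divr_gt0.
have := @box_torus_integral (torus_bump r c) c (Num.min (e / 2) r) (torus_bump r c c / 2)
  (@torus_bump_integrable r c) (ltW b20) er0.
move=> h; apply: lt_le_trans (h _ _).
- by rewrite mulr_gt0// exprn_gt0// mulr_gt0.
- move=> x xc; split.
    by apply: rU => i; apply: lt_le_trans (xc i) _; rewrite ge_min lexx orbT.
  have : ball c e x.
    rewrite -ball_normE /= distrC; apply: (@le_lt_trans _ _ (e / 2)); last by lra.
    apply: rV_norm_le; first lra; move=> i; rewrite !mxE.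
    by apply: le_trans (ltW (xc i)) _; rewrite ge_min lexx.
  by move=> /eb /=; rewrite ltr_norml => /andP[]; lra.
- by move=> x _; exact: torus_bump_ge0.
Qed.

End tensor.

(** * Far apart wavelets in a dyadic cube *)

Section spread.
Context {R : realType} {d : nat} (f : 'rV[R]_d -> R).

Definition pwav (j : nat) (k : 'rV['I_(2 ^ j)]_d) : 'rV[R]_d -> R :=
  periodized f j (shift_of k).

(* The wavelets [pwav (k a)] behave like bumps with disjoint supports located in
   a given dyadic cube. *)
Definition spread_family (c gamma : R) (D : nat) (z : 'rV['I_(2 ^ D)]_d) (N : nat)
    (kappa : R) (j : nat) (k : 'I_N -> 'rV['I_(2 ^ j)]_d)
    (theta : 'I_N -> 'rV[R]_d -> R) : Prop :=
  [/\ injective k,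
      forall a, [/\ forall U, torus_invariant U -> dyadic_cube D (shift_of z) `<=` U ->
                      test_function U (theta a),
                    forall x, `|theta a x| <= 8 ^+ d,
                    forall x, 0 <= theta a x &
                    0 < torus_integral (theta a)],
      exists2 s : R, `|s| = 1 & forall a x, theta a x != 0 -> c <= s * pwav (k a) x,
      forall a b x, a != b ->
        2 ^+ (d * j) * `|pwav (k a) x * pwav (k b) x| <= kappa &
      forall a, gamma <= 2 ^+ (d * j) *
        torus_integral (fun x => pwav (k a) x * pwav (k a) x)].

(** At scale [D + e + t] the index [2^t (2^e z + a + 1)] sits at [z + (a + 1) / 2^e] in units of
    [2^-D]. The shift [a + 1] on one side and [N < 2^e] on the other leave a margin [2^-e] inside
    the cube. *)
Lemma near_dyadic_point (D e t : nat) (z : 'rV['I_(2 ^ D)]_d) (N : nat) (a : 'I_N)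
   (y : 'rV[R]_d) :
  (N < 2 ^ e)%N ->
  (forall i, `|2 ^+ (D + e + t) * y 0 i - (2 ^ t * (2 ^ e * z 0%R i + a.+1))%:R| < 2 ^+ t) ->
  unit_cube R d y /\ dyadic_cube D (shift_of z) y.
Proof.
move=> Ne yk.
have E0 n : 0 < 2 ^+ n :> R by rewrite exprn_gt0.
have h i : (z 0 i)%:R < 2 ^+ D * y 0 i < (z 0 i)%:R + 1.
  have := yk i; rewrite !exprD.
  have -> : (2 ^ t * (2 ^ e * z 0%R i + a.+1))%:R =
      2 ^+ t * (2 ^+ e * (z 0 i)%:R + a%:R + 1) :> R.
    by rewrite natrM natrD natrM !natrX -[a.+1%:R]natr1 addrA.
  have a0 : 0 <= a%:R :> R by [].
  have aN : a%:R + 2 <= 2 ^+ e :> R.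
    rewrite -natrD -natrX ler_nat; apply: leq_trans Ne.
    by rewrite addn2 ltnS.
  have -> : 2 ^+ D * 2 ^+ e * 2 ^+ t * y 0 i - 2 ^+ t * (2 ^+ e * (z 0 i)%:R + a%:R + 1) =
     2 ^+ t * (2 ^+ e * (2 ^+ D * y 0 i - (z 0 i)%:R) - a%:R - 1) by ring.
  rewrite normrM (gtr0_norm (E0 t)) -[ltRHS]mulr1 ltr_pM2l// ltr_norml => /andP[h1 h2].
  have := E0 e; set w := 2 ^+ D * y 0 i in h1 h2 *; set E := 2 ^+ e in aN h1 h2 *.
  by move=> E0'; apply/andP; split; nra.
split=> i.
  have /andP[h1 h2] := h i.
  have D1 := E0 D; apply/andP; split.
    by rewrite -(pmulr_rge0 _ D1) ltW//; apply: le_lt_trans h1.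
  rewrite -(ltr_pM2l D1) mulr1; apply: lt_le_trans h2 _.
  by rewrite natr1 -natrX ler_nat; exact: ltn_ord.
have /andP[h1 h2] := h i; rewrite mxE intrD.
by rewrite !ltW.
Qed.

Context (C : R).
Hypothesis cf : continuous f.
Hypothesis fC : periodization_bound f C.
Hypothesis C1 : 1 <= C.
Hypothesis d0 : (0 < d)%N.
Variable y0 : 'rV[R]_d.
Hypothesis fy0 : f y0 != 0.

Lemma norm_intr_ge1 (n : int) : n != 0 -> 1 <= `|n%:~R : R|.
Proof.
by move=> n0; rewrite -intr_norm -[1]/(1%:~R) ler_int; move: n0; rewrite -normr_gt0; lia.
Qed.

(** In a coordinate the two arguments differ by [2^t] times an integer, which is non-zero because
    [a - b] is not a multiple of [2^(D+e)]. So at any point, for any translates, one of the two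
    wavelets is seen from a distance at least [2^t / 2]. *)
Lemma dyadic_shift_dist (D e t : nat) (z : 'rV['I_(2 ^ D)]_d) (N : nat)
    (k : 'I_N -> 'rV[int]_d) (a b : 'I_N) (x : 'rV[R]_d) (l l' : 'rV[int]_d) :
  (N < 2 ^ e)%N -> a != b ->
  (forall a i, k a 0 i = (2 ^ t * (2 ^ e * z 0%R i + a.+1))%:Z) ->
  2 ^+ t <= `|2 ^+ (D + e + t) *: (x - map_mx intr l) - map_mx intr (k a)| +
            `|2 ^+ (D + e + t) *: (x - map_mx intr l') - map_mx intr (k b)|.
Proof.
move=> Ne ab kE; set u := (X in `|X| + _); set v := (X in _ <= _ + `|X|).
apply: le_trans (ler_normB u v).
apply: le_trans (ler_coord_norm _ (Ordinal d0)).
set i := Ordinal d0.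
pose n : int := (2 ^ (D + e))%:Z * (l' 0 i - l 0 i) - a%:Z + b%:Z.
have -> : (u - v) 0 i = 2 ^+ t * n%:~R.
  rewrite /u /v !mxE !kE /n intrD intrB intrM intrB !exprD.
  rewrite -!pmulrn !natrM !natrD !natrM !natrX -[a.+1%:R]natr1 -[b.+1%:R]natr1.
  by rewrite exprD; ring.
have n0 : n != 0.
  have aE : ((a : nat) < 2 ^ (D + e))%N.
    by apply: (ltn_trans (ltn_ord a)); apply: (leq_trans Ne); rewrite leq_exp2l// leq_addl.
  have bE : ((b : nat) < 2 ^ (D + e))%N.
    by apply: (ltn_trans (ltn_ord b)); apply: (leq_trans Ne); rewrite leq_exp2l// leq_addl.
  apply/eqP; rewrite /n.
  move: (2 ^ (D + e))%N (l' 0 i - l 0 i : int) aE bE => E q aE bE.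
  have [->|q0] := eqVneq q 0.
    by rewrite mulr0 => /eqP; move: ab; rewrite -val_eqE /=; lia.
  move=> En; have : (E <= `|(E%:Z * q)%R|)%N.
    by rewrite abszM /= leq_pmulr// absz_gt0.
  by move: (E%:Z * q) En => w; lia.
rewrite normrM ger0_norm ?exprn_ge0// ler_peMr ?exprn_ge0//.
exact: norm_intr_ge1.
Qed.

Lemma exp2_ge3 (u v w : R) : exists t, [/\ u <= 2 ^+ t, v <= 2 ^+ t & w <= 2 ^+ t].
Proof.
pose A := Num.max u (Num.max v w); exists (Num.truncn A).+1.
have tA : A <= 2 ^+ (Num.truncn A).+1.
  apply: ltW; apply: lt_trans (truncnS_gt _) _.
  by rewrite -natrX ltr_nat ltn_expl.
by split; apply: le_trans tA; rewrite !le_max lexx ?orbT.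
Qed.

(** Near [y0] the function [f] keeps its sign and most of its size. The scale is [j = D + e + t]:
    [e] makes room for [N] separate indices in the cube, [t] makes all tails small, and the bumps
    are centred at the preimages [xi a] of [y0]. *)
Lemma spread_family_exists : exists c gamma : R, [/\ 0 < c, 0 < gamma &
  forall (D : nat) (z : 'rV['I_(2 ^ D)]_d) (N : nat) (kappa : R), 0 < kappa ->
  exists j (k : 'I_N -> 'rV['I_(2 ^ j)]_d) theta,
    spread_family c gamma z kappa k theta].
Proof.
pose F : R := `|f y0|; have FE : `|f y0| = F by [].
have F0 : 0 < F by rewrite normr_gt0.
move: F FE F0 => F FE F0.
have [r0 r00 r0P] : exists2 r0 : R, 0 < r0 & forall y, `|y0 - y| <= r0 -> `|f y0 - f y| <= F / 4.
  have F4 : 0 < F / 4 by rewrite divr_gt0.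
  have /cvgrPdist_le/(_ _ F4)/nbhs_ballP[r /= r0 rP] := cf (x := y0).
  exists (r / 2); first by rewrite divr_gt0.
  move=> y yr; apply: rP; rewrite -ball_normE /=; lra.
pose rho : R := Num.min r0 2^-1.
have rho0 : 0 < rho by rewrite lt_min r00 invr_gt0/=.
have rho1 : rho <= 2^-1 by rewrite ge_min lexx orbT.
have rr : rho <= r0 by rewrite ge_min lexx.
move: rho rho0 rho1 rr => rho rho0 rho1 rr.
pose sg := Num.sg (f y0).
have sg1 : `|sg| = 1 by rewrite normr_sg fy0.
(* From [F], a quarter is lost to the variation of [f] and a quarter to the other translates.
   [gamma] is the resulting lower bound on the square, integrated over a box of half-side [rho] in
   the variable rescaled by [2^j]. *)
exists (F / 2), ((F / 2) ^+ 2 * (2 * rho) ^+ d); split.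
- by rewrite divr_gt0.
- by rewrite mulr_gt0// exprn_gt0// ?divr_gt0// mulr_gt0.
move=> D z N kappa kappa0.
pose e := N.+1; have Ne : (N < 2 ^ e)%N by apply: ltn_trans (ltn_expl _ _).
pose m0 := `|y0| + 1; have m0E : m0 = `|y0| + 1 by [].
have C0 : 0 < C by apply: lt_le_trans C1.
have A3 : 1 <= m0 by rewrite lerDr.
move: m0 m0E A3 => m0 m0E A3.
(* The three demands on [t], with [M = 2^t / 2]: overlaps at most [kappa], [M] larger than the
   distance [m0] from an index to the support of its bump, and tails [C / M^(d+1)] at most
   [F / 4]. *)
have [t [tK tm tF]] := exp2_ge3 (2 ^+ (d * (D + e)) * (C * C) * 2 ^+ d.+1 / kappa)
  (2 * m0 + 2) (8 * C / F).
pose M : R := 2 ^+ t / 2.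
have tM : 2 ^+ t = M * 2 by rewrite /M divfK.
have Mt : M = 2 ^+ t / 2 by [].
move: M tM Mt => M tM Mt.
have M1 : 1 <= M by move: tm A3; rewrite tM; lra.
have Mm0 : m0 <= M by move: tm; rewrite tM; lra.
have M0 : 0 < M by apply: lt_le_trans M1.
have MC : C / M ^+ d.+1 <= F / 4.
  rewrite ler_pdivrMr ?exprn_gt0//; apply: (@le_trans _ _ (F / 4 * M)).
    by move: tF; rewrite tM ler_pdivrMr//; lra.
  by rewrite ler_pM2l ?divr_gt0// -[leLHS]expr1 ler_weXn2l.
pose j := (D + e + t)%N.
have Mkappa : 2 ^+ (d * j) * (C * (C / M ^+ d.+1)) <= kappa.
  have -> : 2 ^+ (d * j) * (C * (C / M ^+ d.+1)) =
      2 ^+ (d * (D + e)) * (C * C) * 2 ^+ d.+1 / 2 ^+ t.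
    have TE : 2 ^+ (d * j) = 2 ^+ (d * (D + e)) * (2 ^+ t) ^+ d :> R.
      by rewrite /j mulnDr exprD -exprM [(t * d)%N]mulnC.
    rewrite TE Mt expr_div_n [(2 ^+ t) ^+ d.+1]exprS.
    set T := 2 ^+ t; set W := T ^+ d; set Q := 2 ^+ d.+1; set P := 2 ^+ (d * _).
    have T0 : T != 0 by rewrite gt_eqF// exprn_gt0.
    have W0 : W != 0 by rewrite expf_neq0.
    have Q0 : Q != 0 by rewrite gt_eqF// exprn_gt0.
    by field; rewrite T0 W0 Q0.
  by rewrite ler_pdivrMr ?exprn_gt0// [leRHS]mulrC -ler_pdivrMr.
have klt a i : (2 ^ t * (2 ^ e * z 0%R i + (a : 'I_N).+1) < 2 ^ j)%N.
  rewrite /j [(D + e + t)%N]addnC expnD ltn_pmul2l ?expn_gt0// [(D + e)%N]addnC expnD.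
  apply: (@leq_trans (2 ^ e * (z 0%R i).+1)%N); last first.
    by rewrite leq_mul2l ltn_ord orbT.
  by rewrite mulnS addnC ltn_add2r (leq_ltn_trans (ltn_ord a)).
pose k a : 'rV['I_(2 ^ j)]_d := \row_i Ordinal (klt a i).
have kE a i : shift_of (k a) 0 i = (2 ^ t * (2 ^ e * z 0%R i + (a : 'I_N).+1))%:Z.
  by rewrite !mxE.
pose J : R := 2 ^+ j; have J0 : 0 < J by rewrite exprn_gt0.
have JE : 2 ^+ j = J by [].
pose xi a := J^-1 *: (map_mx intr (shift_of (k a)) + y0).
have rJ : 0 < rho / J <= 2^-1.
  rewrite divr_gt0//= ler_pdivrMr//; apply: le_trans rho1 _.
  by rewrite ler_peMr ?invr_ge0// -JE exprn_ege1// ler1n.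
have key a (x : 'rV[R]_d) : (forall i, `|x 0 i - xi a 0 i| <= rho / J) ->
  [/\ unit_cube R d x, dyadic_cube D (shift_of z) x & F / 2 <= sg * pwav (k a) x].
  move=> xr.
  have xky i : `|J * x 0 i - (shift_of (k a) 0 i)%:~R - y0 0 i| <= rho.
    have -> : J * x 0 i - (shift_of (k a) 0 i)%:~R - y0 0 i = (x 0 i - xi a 0 i) * J.
      have Jn0 : J != 0 by rewrite gt_eqF.
      by rewrite /xi !mxE; field.
    by rewrite normrM (gtr0_norm J0) -ler_pdivlMr//; exact: xr.
  have xk i : `|J * x 0 i - (shift_of (k a) 0 i)%:~R| < m0.
    have := ler_normD (J * x 0 i - (shift_of (k a) 0 i)%:~R - y0 0 i) (y0 0 i).
    rewrite subrK => /le_lt_trans; apply; rewrite m0E addrC ler_ltD ?ler_coord_norm//.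
    by apply: le_lt_trans (xky i) _; move: rho1; lra.
  have [|xU xD] := @near_dyadic_point D e t z N a x Ne.
    move=> i; have := xk i; rewrite kE => /lt_le_trans; apply.
    by apply: le_trans Mm0 _; rewrite tM; move: M0; lra.
  split => //.
  (* Only the translate [l = 0] counts: the others are at distance at least [2M - m0 >= M]. *)
  have := @periodized_approx _ _ _ _ fC j (shift_of (k a)) x [:: 0] M isT M0.
  rewrite big_seq1 map_mx0 subr0 JE => h.
  have fx : `|f y0 - f (J *: x - map_mx intr (shift_of (k a)))| <= F / 4.
    apply: r0P; rewrite distrC; apply: rV_norm_le => [|i]; first exact: ltW.
    by have := le_trans (xky i) rr; rewrite !mxE.
  have sF : sg * f y0 = F by rewrite -normrEsg.
  move: fx; rewrite -/(pwav (k a) x) in h *; set w := f (J *: _ - _) in h *.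
  set p := pwav (k a) x in h * => fx.
  have {}fx : `|sg * (f y0 - w)| <= F / 4 by rewrite normrM sg1 mul1r.
  have {h} : `|sg * (p - w)| <= F / 4.
    rewrite normrM sg1 mul1r; apply: le_trans MC; apply: h => l.
    rewrite inE => l0.
    have [i li] : exists i, l 0 i != 0.
      apply/existsP; apply: contraR l0 => /existsPn l0; apply/eqP/rowP => i.
      by rewrite mxE; apply/eqP; have := l0 i; rewrite negbK.
    have JM : 2 * M <= J.
      rewrite mulrC -tM -JE ler_weXn2l ?ler1n// /j; exact: leq_addl.
    apply: le_trans (lerD (lexx 1) (ler_coord_norm _ i)); rewrite !mxE.
    have li1 : 1 <= `|(l 0 i)%:~R : R|.
      exact: norm_intr_ge1.
    have := lerB_dist (J * (l 0 i)%:~R) (J * x 0 i - (shift_of (k a) 0 i)%:~R).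
    rewrite normrM (gtr0_norm J0) (distrC (J * _)) addrAC -mulrBr.
    have := ler_wpM2l (ltW J0) li1; have := xk i; move: JM Mm0; rewrite !mxE; lra.
  move: fx; rewrite !mulrBr sF !ler_norml => /andP[? ?] /andP[? ?]. lra.
exists j, k, (fun a => torus_bump (rho / J) (xi a)); split.
- move=> a b /(congr1 (fun v => shift_of v 0 (Ordinal d0))); rewrite !kE => -[/eqP].
  by rewrite eqn_pmul2l ?expn_gt0// eqn_add2l eqSS => /eqP/val_inj.
- move=> a; have [rJ0 rJ1] := andP rJ; split.
  + move=> U iU DU; apply: torus_bump_test => //; first by rewrite rJ1 ltW.
    by move=> x /key[_ /DU].
  + exact: torus_bump_norm_le.
  + exact: torus_bump_ge0.
  + apply: torus_bump_integral_gt0 => // x xr.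
    by have [|] := key a x _; first by move=> i; exact: ltW.
- exists sg => // a x xn0.
  have rJ' : 0 <= rho / J <= 2^-1 by case/andP: rJ => [/ltW -> ->].
  have [l] := closure_torus_bump rJ' (@subset_closure _ [set y | torus_bump (rho / J) (xi a) y != 0] x xn0).
  by move=> /key[_ _]; rewrite /pwav (periodized_periodic fC).
- move=> a b x ab; apply: le_trans Mkappa; apply: ler_wpM2l; first by rewrite exprn_ge0.
  have CM0 : 0 <= C / M ^+ d.+1 by rewrite divr_ge0 ?exprn_ge0// ltW.
  rewrite normrM.
  (* Either every translate of wavelet [a] is far from [x], or one is near and [dyadic_shift_dist]
     puts all translates of wavelet [b] far away. One factor is at most [C], the other at most
     [C / M^(d+1)]. *)
  have [h|/existsNP[l /negP]] := pselect (forall l : 'rV[int]_d,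
      M <= 1 + `|2 ^+ j *: (x - map_mx intr l) - map_mx intr (shift_of (k a))|).
    by rewrite mulrC; apply: ler_pM => //; [exact: (periodized_le fC)|exact: (periodized_decay fC)].
  rewrite -ltNge => h; apply: ler_pM => //; first exact: (periodized_le fC).
  apply: (periodized_decay fC) => // l'.
  have := @dyadic_shift_dist D e t z N (fun a => shift_of (k a)) a b x l l' Ne ab kE.
  by move: h; rewrite -/j tM; lra.
- move=> a; have [rJ0 rJ1] := andP rJ.
  have pc : continuous (pwav (k a)) by exact: (periodized_continuous fC).
  have h : (F / 2) ^+ 2 * (2 * (rho / J)) ^+ d <=
      torus_integral (fun x => pwav (k a) x * pwav (k a) x).
    apply: (@box_torus_integral _ _ _ (xi a)) => //.
    - apply: (@continuous_torus_integrable _ _ _ (C * C)).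
        by move=> x; apply: continuousM; exact: pc.
      by move=> x; rewrite normrM; apply: ler_pM => //; exact: (periodized_le fC).
    - by rewrite exprn_ge0// divr_ge0// ltW.
    - move=> x xr; have [|xU _ xF] := key a x; first by move=> i; exact: ltW.
      split => //; apply: (@le_trans _ _ ((sg * pwav (k a) x) ^+ 2)).
        by apply: lerXn2r; rewrite ?nnegrE//; move: xF F0; lra.
      by rewrite exprMn sqr_sg fy0 mul1r expr2.
    - by move=> x _; rewrite -expr2 sqr_ge0.
  apply: (@le_trans _ _ (2 ^+ (d * j) * ((F / 2) ^+ 2 * (2 * (rho / J)) ^+ d))).
    rewrite mulnC exprM JE mulrCA ler_pM2l ?exprn_gt0 ?divr_gt0//.
    have Jn0 : J != 0 by rewrite gt_eqF.
    by rewrite -exprMn (_ : J * (2 * (rho / J)) = 2 * rho)//; field.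
  by apply: ler_wpM2l => //; rewrite exprn_ge0.
Qed.
End spread.

(** * The probe and Haar-null sets *)

Section probe.
Context {R : realType} {E : completeNormedModType R} {S : Type}.
Context (stg : nat -> R -> S) (adm : S -> (E -> R) -> Prop) (B : S -> R) (K gamma : R).
Hypothesis B_gt0 : forall s, 0 < B s.
Hypothesis K_gt0 : 0 < K.
Hypothesis gamma_gt0 : 0 < gamma.
Hypothesis adm_lin : forall s l, adm s l ->
  forall x y a, l (x + a *: y) = l x + a * l y.
Hypothesis adm_bound : forall s l, adm s l -> forall x, `|l x| <= B s * `|x|.
Hypothesis adm_perturb : forall n (eps : R) g, 0 < eps -> exists b : E,
  `|b| <= K /\ forall l, adm (stg n eps) l -> gamma * eps <= `|l (g + eps *: b)|.

(* The later weights sum to at most [2 zeta (stg n (eps n)) eps n], so that they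
   perturb the functionals of stage [n] by at most [gamma / 2 * eps n]. *)
Let zeta (s : S) : R := Num.min 2^-1 (gamma / (4 * K * B s)).

Let zeta_gt0 s : 0 < zeta s.
Proof. by rewrite lt_min invr_gt0 ltr0n /= divr_gt0// !mulr_gt0. Qed.

(** A greedy series: [b] is chosen at the current partial sum so that the functionals of stage [n]
    reach [gamma * eps n], and later terms cost at most half of that. A stage depends on its weight,
    and the next weight on the stage, hence the recursion. *)
Lemma probe_exists : exists (g : E) (eps : nat -> R), (forall n, 0 < eps n) /\
  forall n l, adm (stg n (eps n)) l -> gamma / 2 * eps n <= `|l g|.
Proof.
have /choice[b bP] : forall p : nat * R * E, exists b : E, 0 < p.1.2 ->
    `|b| <= K /\ forall l, adm (stg p.1.1 p.1.2) l ->
      gamma * p.1.2 <= `|l (p.2 + p.1.2 *: b)|.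
  move=> [[n eps] g] /=; have [e0|e0] := ltP 0 eps; last by exists 0.
  by have [b bP] := adm_perturb n g e0; exists b.
(* The state holds the weight of the coming stage and the partial sum so far. *)
pose st := fix st (n : nat) : R * E := if n is m.+1 then
  let: (eps, g) := st m in
  (eps * zeta (stg m eps), g + eps *: b (m, eps, g)) else (1, 0).
pose eps n := (st n).1; pose g n := (st n).2.
have epsS n : eps n.+1 = eps n * zeta (stg n (eps n)).
  by rewrite /eps /=; case: (st n).
have gS n : g n.+1 = g n + eps n *: b (n, eps n, g n).
  by rewrite /g /eps /=; case: (st n).
have eps0 n : 0 < eps n.
  by elim: n => [|n IH]; [rewrite /eps /= ltr01|rewrite epsS mulr_gt0].
have epsh n : eps n.+1 <= eps n / 2.
  by rewrite epsS ler_pM2l// ge_min lexx.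
(* Since [eps n <= 2 (eps n - eps n.+1)], the increments have telescoping bounds. *)
have gstep n : `|g n.+1 - g n| <= 2 * K * (eps n - eps n.+1).
  rewrite gS addrC addKr normrZ gtr0_norm//.
  have [bK _] := bP (n, eps n, g n) (eps0 n).
  apply: (@le_trans _ _ (eps n * K)); first by rewrite ler_pM2l.
  rewrite -mulrA mulrCA mulrC ler_pM2l//; have := epsh n; lra.
have gdist n m : `|g (n + m)%N - g n| <= 2 * K * (eps n - eps (n + m)%N).
  elim: m => [|m IH]; first by rewrite addn0 !subrr normr0 mulr0.
  rewrite addnS; have := gstep (n + m)%N.
  have := ler_normD (g (n + m).+1 - g (n + m)%N) (g (n + m)%N - g n).
  rewrite addrA subrK; move: IH; set u := `|_|; set v := `|_|; set w := `|_|; lra.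
have gn n m : (n <= m)%N -> `|g m - g n| <= 2 * K * eps n.
  move=> /subnKC <-; apply: le_trans (gdist _ _) _.
  by apply: ler_wpM2l; [rewrite !mulr_ge0// ltW|rewrite gerBl ltW].
have eps2 n : eps n <= 2 ^- n.
  elim: n => [|n IH]; first by rewrite expr0 invr1 /eps /=.
  by apply: le_trans (epsh n) _; rewrite exprSr invfM ler_pM2r ?invr_gt0.
have eps_small e : 0 < e -> exists n, 2 * K * eps n < e.
  move=> e0; pose n := (Num.truncn (2 * K / e)).+1; exists n.
  apply: (@le_lt_trans _ _ (2 * K * 2 ^- n)); first by apply: ler_wpM2l; [rewrite mulr_ge0// ltW|exact: eps2].
  rewrite ltr_pdivrMr ?exprn_gt0// [ltRHS]mulrC -ltr_pdivrMr//.
  apply: lt_trans (truncnS_gt _) _; rewrite -/n.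
  by rewrite -natrX ltr_nat ltn_expl.
have : cvg (g @ \oo).
  apply/cauchy_cvgP/cauchyP => e /eps_small[n ne]; exists (g n).
  exists n => // m nm; rewrite -ball_normE /= distrC.
  exact: le_lt_trans (gn _ _ nm) ne.
move=> /cvg_ex[gl /cvgrPdist_lt gcv]; exists gl, eps; split => // n l al.
have glim : `|gl - g n.+1| <= 2 * K * eps n.+1.
  apply/ler_addgt0Pr => e e0; have [m _ mP] := gcv e e0.
  have h1 := mP (maxn m n.+1) (leq_maxl _ _); have h2 := gn _ _ (leq_maxr m n.+1).
  rewrite -[gl](subrK (g (maxn m n.+1))) -addrA (le_trans (ler_normD _ _))// [leLHS]addrC.
  by apply: lerD => //; exact: ltW.
have [_ /(_ l al) /= lg] := bP (n, eps n, g n) (eps0 n).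
rewrite -gS in lg.
have lgl : l gl = l (g n.+1) + l (gl - g n.+1).
  by rewrite -[in LHS](subrK (g n.+1) gl) addrC -[gl - _]scale1r (adm_lin al) scale1r mul1r.
have h : `|l (gl - g n.+1)| <= gamma / 2 * eps n.
  apply: le_trans (adm_bound al _) _.
  apply: (@le_trans _ _ (B (stg n (eps n)) * (2 * K * eps n.+1))).
    by rewrite ler_pM2l.
  rewrite epsS; set s := stg n (eps n).
  apply: (@le_trans _ _ (B s * (2 * K * (eps n * (gamma / (4 * K * B s)))))).
    do !(rewrite ler_pM2l ?mulr_gt0//).
    by rewrite ge_min lexx orbT.
  rewrite le_eqVlt; apply/orP; left; apply/eqP.
  by field; rewrite !gt_eqF.
have := lerB_normD (l (g n.+1)) (l (gl - g n.+1)); rewrite -lgl; lra.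
Qed.

End probe.

Lemma continuous_borel_measurable (R : realType) (E : completeNormedModType R)
    (h : R -> E) : continuous h ->
  measurable_fun setT (h : measurableTypeR R -> g_sigma_algebraType (@open E)).
Proof.
move=> ch _ Y mY; rewrite setTI.
suff : [set A | measurable (h @^-1` A)] Y by [].
move: Y mY; apply: smallest_sub.
  split => /=; first by rewrite preimage_set0.
  - by move=> A mA; rewrite setTD preimage_setC; exact: measurableC.
  - by move=> F mF; rewrite preimage_bigcup; exact: bigcup_measurable.
move=> U oU /=; apply: open_measurable.
by apply: open_comp => // t _; exact: ch.
Qed.

(** The point [t g] lies in [x + N] exactly when [t g - x] lies in [N]; the law of [t g] for uniform
    [t] is carried by the compact segment from 0 to [g]. *)
Lemma line_haar_null (R : realType) (E : completeNormedModType R) (g : E) (N : set E) :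
  borel N ->
  (forall x : E, lebesgue_measure [set t : R | N (t *: g - x)] = 0%E) ->
  haar_null_borel N.
Proof.
move=> bN Nx; split => //.
have mcont := @continuous_borel_measurable R E.
have cL : continuous (fun t : R => t *: g).
  move=> t; apply: (@cvgZ _ _ _ (nbhs t) _ id (cst g)) => //.
  exact: cvg_cst.
pose L := mfun_Sub (mem_set (mcont _ cL)).
have DE A : distribution (uniform_prob (@ltr01 R)) L A =
    (\int[lebesgue_measure]_(x in L @^-1` A) (uniform_pdf 0 1 x)%:E)%E by [].
exists (distribution (uniform_prob (@ltr01 R)) L); split.
  exists ((fun t : R => t *: g) @` `[0, 1]%classic).
    by apply: continuous_compact (@segment_compact _ _ _); exact: continuous_subspaceT.
  apply: etrans (DE _) _; rewrite integral_uniform_pdf1//.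
  by move=> t t01; exists t.
move=> x; apply: etrans (DE _) _; rewrite integral_uniform_pdf.
set A := _ `&` _.
have AE : A = [set t : R | 0 <= t <= 1 /\ N (t *: g - x)].
  apply/seteqP; split => t; rewrite /A /= in_itv /=.
    by move=> [[a Na xa] t01]; split => //; rewrite -xa addrC addKr.
  by move=> [t01 Nt]; split => //; exists (t *: g - x) => //; rewrite addrC subrK.
have mN : measurable [set t : R | N (t *: g - x)].
  rewrite -[X in measurable X]setTI.
  have cLx : continuous (fun t : R => t *: g - x).
    by move=> t; apply: cvgB; [exact: cL|exact: cvg_cst].
  exact: (mcont _ cLx measurableT N bN).
have mA : measurable A.
  have -> : A = [set t : R | N (t *: g - x)] `&` `[0, 1]%classic.
    rewrite AE; apply/seteqP; split => t; rewrite /= in_itv /=; tauto.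
  exact: measurableI.
apply: null_set_integral => //.
  apply: measurable_funTS; apply: measurableT_comp => //.
  exact: measurable_uniform_pdf.
apply/eqP; rewrite eq_le measure_ge0 andbT -(Nx x) le_measure ?inE//.
by rewrite AE => t [].
Qed.

(** Markov's inequality for the number of sets [W a] containing [t], whose integral is at most
    [2 h delta]. *)
Lemma counting_markov d (T : measurableType d) (R : realType)
    (mu : {measure set T -> \bar R}) (I : finType) (W : I -> set T)
    (F : set T) (h : nat) (delta : R) :
  (forall a, measurable (W a)) -> measurable F -> (0 < h)%N -> #|I| = (2 * h)%N ->
  (forall a, mu (W a) <= delta%:E)%E ->
  (forall t, F t -> (h <= #|[pred a | `[< W a t >]]|)%N) ->
  (mu F <= (2 * delta)%:E)%E.
Proof.
move=> mW mF h0 Ih Wd FW.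
have i0 (A : set T) t : (0 <= (\1_A t)%:E :> \bar R)%E by rewrite lee_fin.
have mi (A : set T) : measurable A -> measurable_fun setT (fun t => (\1_A t)%:E : \bar R).
  by move=> mA; apply/measurable_EFinP; exact: measurable_indic.
have : (h%:R%:E * mu F <= \sum_(a : I) mu (W a))%E.
  have muE (A : set T) : measurable A -> mu A = (\int[mu]_t (\1_A t)%:E)%E.
    by move=> mA; rewrite integral_indic// setIT.
  rewrite muE// -ge0_integralZl_EFin//; last exact: mi.
  under [leRHS]eq_bigr do rewrite muE//.
  rewrite -ge0_integral_sum//; last by move=> a; exact: mi.
  apply: ge0_le_integral => //.
  - by apply: measurable_funeM; exact: mi.
  - by apply: emeasurable_sum => a; exact: mi.
  - move=> t _; rewrite sumEFin indicE.
    have [|tF] := boolP (t \in F); last by rewrite mule0 lee_fin sumr_ge0.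
    rewrite inE => /FW ht; rewrite mule1 lee_fin.
    apply: (@le_trans _ _ (#|[pred a | `[< W a t >]]|%:R)); first by rewrite ler_nat.
    rewrite -sum1_card natr_sum big_mkcond; apply: ler_sum => a _.
    by rewrite inE indicE; case: asboolP => [Wt|//]; rewrite mem_set.
move=> hS; have hR : 0 < h%:R :> R by rewrite ltr0n.
rewrite -(@lee_pmul2l _ h%:R%:E)// ?lte_fin//.
apply: le_trans hS _; apply: (@le_trans _ _ (\sum_(a : I) delta%:E)%E).
  by apply: lee_sum => a _; exact: Wd.
rewrite sumEFin sumr_const Ih -EFinM lee_fin -[delta *+ _]mulr_natr natrM; lra.
Qed.

Section good.
Context {R : realType} {E : completeNormedModType R}.
Context (h : nat -> nat) (l : forall n, 'I_(2 * h n) -> E -> R) (g : E) (beta : nat -> R).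
Hypothesis lc : forall n a, continuous (@l n a).
Hypothesis l_line : forall n a t x, @l n a (t *: g - x) = t * @l n a g - @l n a x.
Hypothesis beta_gt0 : forall n, 0 < beta n.
Hypothesis lg : forall n a, beta n <= `|@l n a g|.

Definition good (n : nat) : set E :=
  [set f | (h n <= #|[pred a | (beta n / (2 ^ n.+1)%:R <= `|@l n a f|)%R]|)%N].

(** A finite union, over the sets of at least [h n] indices, of finite intersections of closed
    sets. *)
Lemma borel_good n : borel (good n).
Proof.
have -> : good n = \bigcup_(A in [set A : {set 'I_(2 * h n)} | (h n <= #|A|)%N])
    \bigcap_(a in [set` A]) [set f | beta n / (2 ^ n.+1)%:R <= `|@l n a f|].
  apply/seteqP; split => [f gf|f [A /= hA fA]].
    exists [set a | (beta n / (2 ^ n.+1)%:R <= `|@l n a f|)%R]%SET.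
      by rewrite /= cardsE.
    by move=> a /=; rewrite inE.
  apply: leq_trans hA _; apply: subset_leq_card; apply/fintype.subsetP => a aA.
  by rewrite inE /=; exact: fA.
suff : @measurable _ (g_sigma_algebraType (@open E))
  (\bigcup_(A in [set A : {set 'I_(2 * h n)} | (h n <= #|A|)%N])
    \bigcap_(a in [set` A]) [set f | beta n / (2 ^ n.+1)%:R <= `|@l n a f|]) by [].
apply: fin_bigcup_measurable; first exact: finite_finset.
move=> A _; apply: fin_bigcap_measurable; first exact: finite_finset.
move=> a _; rewrite -[X in measurable X]setCK; apply: measurableC.
apply: sub_sigma_algebra; apply: closed_openC.
apply: (closed_comp (D := [set t : R | beta n / (2 ^ n.+1)%:R <= t])) => //.
move=> f _; apply: (continuous_comp (@lc n a f)); exact: norm_continuous.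
Qed.

(** As [|l g| >= beta n], each functional is below [beta n / 2^(n+1)] on an interval of the line of
    length at most [2 / 2^(n+1)]. A bad point has more than [h n] such functionals, so bad points
    have measure at most [4 / 2^(n+1)], which is summable. *)
Lemma haar_null_limsup_bad : haar_null_borel (lim_sup_set (fun n => ~` good n)).
Proof.
have bgood n : @measurable _ (g_sigma_algebraType (@open E)) (~` good n).
  by apply: measurableC; exact: borel_good.
apply: (@line_haar_null _ _ g).
  suff : @measurable _ (g_sigma_algebraType (@open E)) (lim_sup_set (fun n => ~` good n)) by [].
  apply: bigcapT_measurable => n; apply: bigcup_measurable => m _; exact: bgood.
move=> x.
pose F n := [set t : R | ~ good n (t *: g - x)].
have -> : [set t : R | lim_sup_set (fun n => ~` good n) (t *: g - x)] = lim_sup_set F by [].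
pose W n (a : 'I_(2 * h n)) : set R :=
  [set t | `|t * @l n a g - @l n a x| < beta n / (2 ^ n.+1)%:R].
have T0 n : 0 < beta n / (2 ^ n.+1)%:R by rewrite divr_gt0// ltr0n expn_gt0.
have lg0 n a : 0 < `|@l n a g| by apply: lt_le_trans (lg a).
have WE n a : @W n a = `](@l n a x / @l n a g - beta n / (2 ^ n.+1)%:R / `|@l n a g|),
   (@l n a x / @l n a g + beta n / (2 ^ n.+1)%:R / `|@l n a g|)[%classic.
  have E1 t : `|t * @l n a g - @l n a x| =
      `|t - @l n a x / @l n a g| * `|@l n a g|.
    by rewrite -normrM mulrBl divfK// -normr_gt0.
  by apply/seteqP; split => t; rewrite /W /= in_itv /= -ltr_distl E1 -ltr_pdivlMr.
have mW n a : measurable (@W n a) by rewrite WE; exact: measurable_itv.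
have notgood n t : F n t -> (h n <= #|[pred a | `[< @W n a t >]]|)%N.
  pose A := [pred a : 'I_(2 * h n) | (beta n / (2 ^ n.+1)%:R <= `|@l n a (t *: g - x)|)%R].
  rewrite /F /good /= -/A => /negP; rewrite -ltnNge => gt.
  have -> : #|[pred a | `[< @W n a t >]]| = #|[predC A]|.
    by apply: eq_card => a; rewrite !inE /= -ltNge l_line; apply/asboolP/idP.
  have := cardC A; rewrite card_ord; move: gt; move: #|A| #|[predC A]| => u v; lia.
have mF n : measurable (F n).
  have cL : continuous (fun t : R => t *: g - x).
    move=> t; apply: cvgB; last exact: cvg_cst.
    by apply: (@cvgZ _ _ _ (nbhs t) _ id (cst g)) => //; exact: cvg_cst.
  have := continuous_borel_measurable cL measurableT (bgood n).
  by rewrite setTI.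
have muW n a : (lebesgue_measure (@W n a) <= (2 / (2 ^ n.+1)%:R)%:E)%E.
  rewrite WE lebesgue_measure_itv /= lte_fin; case: ifP => _; last first.
    by rewrite lee_fin divr_ge0.
  have : beta n / (2 ^ n.+1)%:R / `|@l n a g| <= (2 ^ n.+1)%:R^-1.
    by rewrite ler_pdivrMr// mulrC ler_pM2l// invr_gt0 ltr0n expn_gt0.
  by rewrite -EFinB lee_fin; lra.
have muF n : (lebesgue_measure (F n) <= (4 / (2 ^ n.+1)%:R)%:E)%E.
  (* Markov's inequality divides by [h n]; when [h n = 0] every point is good. *)
  have [h0|h0] := posnP (h n).
    rewrite (_ : F n = set0) ?measure0 ?lee_fin ?divr_ge0//.
    by rewrite -subset0 => t; apply; rewrite /good /=; move: #|_| => u; rewrite h0.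
  have -> : 4 / (2 ^ n.+1)%:R = 2 * (2 / (2 ^ n.+1)%:R) :> R by lra.
  apply: (@counting_markov _ (measurableTypeR R) R (@lebesgue_measure R)
    'I_(2 * h n) (@W n) (F n) (h n) (2 / (2 ^ n.+1)%:R)) => //.
  - by move=> a; exact: mW.
  - exact: mF.
  - exact: card_ord.
  - by move=> a; exact: muW.
  - by move=> t; exact: notgood.
apply: lim_sup_set_cvg0 => //.
apply: (@le_lt_trans _ _ (\sum_(n <oo) (4 / (2 ^ n.+1)%:R)%:E)%E).
  by apply: lee_nneseries => // n _; exact: muF.
by apply: (le_lt_trans (epsilon_trick0 _ _)); rewrite ?ltry.
Qed.
End good.

(** * Wavelet coefficients and pairings *)

Lemma seq_argmax (R : realType) (I : eqType) (F : seq I) (u : I -> R) (a : I) :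
  a \in F -> exists2 b, b \in F & forall x, x \in F -> u x <= u b.
Proof.
move=> aF; have [s [b bF bs]] : exists s : seq I, exists2 b, b \in F &
    forall x, x \in F -> u x <= u b.
  elim: F a aF => [//|y F IH] a _.
  case: F IH => [|z F] IH.
    by exists [::], y; rewrite ?mem_head// => x; rewrite inE => /eqP ->.
  have [s [b bF bs]] := IH z (mem_head _ _).
  have [yb|yb] := leP (u y) (u b).
    exists [::], b; first by rewrite inE bF orbT.
    by move=> x; rewrite inE => /predU1P[->//|]; exact: bs.
  exists [::], y; first exact: mem_head.
  move=> x; rewrite inE => /predU1P[->//|/bs xb].
  exact: le_trans xb (ltW yb).
by exists b.
Qed.

(** In the row [a] where [|u a|] is largest, the off-diagonal terms amount to at most half the lower
    bound on the diagonal one. *)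
Lemma diag_dominant (R : realType) (I : eqType) (F : seq I) (p : I -> I -> R)
    (u w : I -> R) (c delta mu : R) : uniq F -> 0 < c -> 0 <= delta ->
  delta * (size F)%:R <= c / 2 ->
  (forall a, a \in F -> 0 < w a) ->
  (forall a, a \in F -> c * w a <= `|p a a|) ->
  (forall a b, a \in F -> b \in F -> a != b -> `|p a b| <= delta * w a) ->
  (forall a, a \in F -> `|\sum_(b <- F) p a b * u b| <= mu * w a) ->
  forall a, a \in F -> `|u a| <= 2 * mu / c.
Proof.
move=> uF c0 de0 dF w0 pd po pu a1 a1F.
have [a aF amax] := seq_argmax (fun b => `|u b|) a1F.
apply: le_trans (amax _ a1F) _; set D := `|u a|.
have := pu a aF; rewrite (perm_big _ (perm_to_rem aF)) big_cons /= => h.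
have wa := w0 a aF; have D0 : 0 <= D by exact: normr_ge0.
have h1 : `|\sum_(b <- rem a F) p a b * u b| <= delta * (size F)%:R * (w a * D).
  apply: le_trans (ler_norm_sum _ _ _) _.
  apply: (@le_trans _ _ (\sum_(b <- rem a F) delta * (w a * D))).
    rewrite big_seq [leRHS]big_seq; apply: ler_sum => b bF.
    have bF' := mem_rem bF.
    have ab : a != b by apply: contraTneq bF => <-; rewrite mem_rem_uniqF.
    by rewrite normrM mulrA; apply: ler_pM => //; [exact: po|exact: amax].
  rewrite big_const_seq count_predT iter_addr_0 size_rem// -[_ *+ (size F).-1]mulr_natr.
  rewrite [leLHS]mulrAC; apply: ler_wpM2r; first exact: mulr_ge0 (ltW wa) D0.
  by rewrite ler_wpM2l// ler_nat leq_pred.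
have h2 : c * w a * D <= `|p a a * u a| by rewrite normrM ler_wpM2r// pd.
have h3 := le_trans h1 (ler_wpM2r (mulr_ge0 (ltW wa) D0) dF).
have h4 := ler_normB (p a a * u a + \sum_(b <- rem a F) p a b * u b) (\sum_(b <- rem a F) p a b * u b).
rewrite addrK in h4.
have h5 : c / 2 * D * w a <= mu * w a by lra.
move: h5; rewrite ler_pM2r// => h5.
by rewrite ler_pdivlMr//; lra.
Qed.

Lemma signed_sum_ge (R : realType) (N : nat) (s q : 'I_N -> R) (a : 'I_N) (gamma kappa : R) :
  (forall b, `|s b| = 1) -> gamma <= q a -> (forall b, b != a -> `|q b| <= kappa) ->
  0 <= kappa -> kappa * N%:R <= gamma / 2 ->
  gamma / 2 <= s a * \sum_b s b * q b.
Proof.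
move=> s1 qa qb k0 kN; rewrite (bigD1 a)//= mulrDr.
have -> : s a * (s a * q a) = q a.
  by rewrite mulrA -expr2 -[s a ^+ 2]real_normK ?num_real// s1 expr1n mul1r.
have : `|s a * \sum_(b | b != a) s b * q b| <= kappa * N%:R.
  rewrite normrM s1 mul1r; apply: le_trans (ler_norm_sum _ _ _) _.
  apply: (@le_trans _ _ (\sum_(b | b != a) kappa)).
    by apply: ler_sum => b ba; rewrite normrM s1 mul1r qb.
  rewrite sumr_const -[kappa *+ _]mulr_natr; apply: ler_wpM2l => //.
  by rewrite ler_nat -[leqRHS]card_ord max_card.
by rewrite ler_norml => /andP[? _]; lra.
Qed.

Section coef.
Context {R : realType} {d : nat} (f : 'rV[R]_d -> R) (C : R).
Hypothesis cf : continuous f.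
Hypothesis fC : periodization_bound f C.
Hypothesis C1 : 1 <= C.

Lemma pwav_continuous j (k : 'rV['I_(2 ^ j)]_d) : continuous (pwav f k).
Proof. exact: (periodized_continuous fC). Qed.

Lemma pwav_le j (k : 'rV['I_(2 ^ j)]_d) x : `|pwav f k x| <= C.
Proof. exact: (periodized_le fC). Qed.

Lemma pwavP j (k : 'rV['I_(2 ^ j)]_d) : pwav f k \in torus_continuous.
Proof.
rewrite inE; split; first exact: pwav_continuous.
exact: (periodized_periodic fC).
Qed.

Definition cwav j (k : 'rV['I_(2 ^ j)]_d) : ctorus R d := CTorus (pwavP k).

(** [wavelet_coef] for the single wavelet [f], on the normed space [ctorus], where it is a
    continuous linear functional. *)
Definition coef j (k : 'rV['I_(2 ^ j)]_d) (h : ctorus R d) : R :=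
  2 ^+ (d * j) * torus_integral (fun x => h x * pwav f k x).

Lemma coef_integrable j (k : 'rV['I_(2 ^ j)]_d) (h : ctorus R d) :
  torus_integrable (fun x => h x * pwav f k x).
Proof.
apply: (@continuous_torus_integrable _ _ _ (`|h| * C)).
  move=> x; apply: continuousM; [exact: ctorus_continuous|exact: pwav_continuous].
move=> x; rewrite normrM; apply: ler_pM => //; [exact: ctorus_norm_ub|exact: pwav_le].
Qed.

Lemma coef_linear j (k : 'rV['I_(2 ^ j)]_d) (g h : ctorus R d) (a : R) :
  coef k (g + a *: h) = coef k g + a * coef k h.
Proof.
rewrite /coef mulrCA -mulrDr; congr (_ * _).
rewrite -torus_integralZ; last exact: coef_integrable.
rewrite -torus_integralD; [|exact: coef_integrable|].
  by congr torus_integral; apply/funext => x /=; rewrite mulrDl mulrA.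
by apply: torus_integrableZ; exact: coef_integrable.
Qed.

Lemma coef_bound j (k : 'rV['I_(2 ^ j)]_d) (h : ctorus R d) :
  `|coef k h| <= 2 ^+ (d * j) * C * `|h|.
Proof.
rewrite /coef normrM ger0_norm ?exprn_ge0// -mulrA ler_wpM2l ?exprn_ge0//.
rewrite -[leRHS](@torus_integral_cst R d).
apply: torus_integral_normr_le; first exact: coef_integrable.
  apply: (@continuous_torus_integrable _ _ _ `|C * `|h| |) => //.
  exact: cst_continuous.
move=> x _; rewrite normrM mulrC; apply: ler_pM => //; [exact: pwav_le|exact: ctorus_norm_ub].
Qed.

Lemma coef_continuous j (k : 'rV['I_(2 ^ j)]_d) : continuous (coef k).
Proof.
move=> h; apply/(@cvgrPdist_le _ _ _ (nbhs h) _ (coef k)) => e e0.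
have B0 : 0 < 2 ^+ (d * j) * C :> R by apply: mulr_gt0; [exact: exprn_gt0|exact: lt_le_trans C1].
have /cvgrPdist_le/(_ (e / (2 ^+ (d * j) * C))) : y @[y --> h] --> h by exact: cvg_id.
rewrite divr_gt0// => /(_ isT); apply: filterS => y yh.
have -> : coef k h - coef k y = coef k (h - y).
  by rewrite -[- y]scaleN1r coef_linear mulN1r.
apply: le_trans (coef_bound _ _) _.
by rewrite mulrC -ler_pdivlMr.
Qed.

Lemma coef_sum j (k : 'rV['I_(2 ^ j)]_d) (I : Type) (s : seq I) (g : I -> ctorus R d) (a : I -> R) :
  coef k (\sum_(i <- s) a i *: g i) = \sum_(i <- s) a i * coef k (g i).
Proof.
elim: s => [|i s IH].
  rewrite !big_nil; have := coef_linear k 0 0 (-1).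
  by rewrite scaler0 addr0 mulN1r subrr.
by rewrite !big_cons addrC coef_linear IH addrC.
Qed.

Lemma ctorus_sumE (I : Type) (s : seq I) (a : I -> R) (g : I -> ctorus R d) x :
  (\sum_(i <- s) a i *: g i) x = \sum_(i <- s) a i * g i x.
Proof.
by elim: s => [|i s IH]; rewrite ?big_nil// !big_cons -IH.
Qed.

(* All the [u a] but the largest one are at most [1 / (N + 1)]. *)
Lemma almost_disjoint_sum (N : nat) (u : 'I_N -> R) :
  (forall a, 0 <= u a <= C) ->
  (forall a b, a != b -> u a * u b <= N.+1%:R^-1 ^+ 2) ->
  \sum_a u a <= C + 1.
Proof.
move=> uC uu; case: N u uC uu => [|N] u uC uu.
  by rewrite big_ord0 addr_ge0// (le_trans ler01).
have [a _ amax] := seq_argmax u (mem_index_enum (ord0 : 'I_N.+1)).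
rewrite (bigD1 a)//=; apply: lerD; first by have /andP[] := uC a.
have N0 : 0 < N.+2%:R :> R by rewrite ltr0n.
apply: (@le_trans _ _ (\sum_(b < N.+1) N.+2%:R^-1)).
  rewrite [leRHS](bigD1 a)//=; apply: (@le_trans _ _ (\sum_(b < N.+1 | b != a) N.+2%:R^-1)).
    apply: ler_sum => b ba; have ub := amax b (mem_index_enum b).
    have /andP[ub0 _] := uC b.
    rewrite -(@ler_pXn2r _ 2)// ?nnegrE ?invr_ge0//.
    by apply: le_trans (uu b a ba); rewrite expr2 ler_wpM2l.
  by rewrite lerDr invr_ge0.
rewrite sumr_const card_ord -[_ *+ _]mulr_natr mulrC ler_pdivrMr// mul1r ler_nat.
exact: leqnSn.
Qed.

(** The signs are those of the coefficients of [g], so that adding [eps *: b] can only help: the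
    diagonal term contributes [gamma] and the cross terms remove at most half. [almost_disjoint_sum]
    bounds the norm of [b] independently of [N]. *)
Lemma perturbation (c gamma : R) (D : nat) (z : 'rV['I_(2 ^ D)]_d) (N : nat)
    (kappa : R) j (k : 'I_N -> 'rV['I_(2 ^ j)]_d) theta (g : ctorus R d) (eps : R) :
  spread_family f c gamma z kappa k theta ->
  0 <= kappa -> kappa <= N.+1%:R^-1 ^+ 2 -> kappa * N%:R <= gamma / 2 -> 0 < eps ->
  exists b : ctorus R d, `|b| <= C + 1 /\
    forall a, gamma / 2 * eps <= `|coef (k a) (g + eps *: b)|.
Proof.
move=> [_ _ _ kk kd] k0 kN kg e0.
pose s a : R := if 0 <= coef (k a) g then 1 else -1.
have s1 a : `|s a| = 1 by rewrite /s; case: ifP; rewrite ?normrN normr1.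
have sg a : s a * coef (k a) g = `|coef (k a) g|.
  rewrite /s; case: ifPn => [h|]; first by rewrite mul1r ger0_norm.
  by rewrite -ltNge => h; rewrite mulN1r ltr0_norm.
exists (\sum_a s a *: cwav (k a)); split.
  apply: ctorus_norm_le => x.
  rewrite ctorus_sumE; apply: le_trans (ler_norm_sum _ _ _) _.
  rewrite (eq_bigr (fun a => `|pwav f (k a) x|)); last first.
    by move=> a _; rewrite normrM s1 mul1r.
  apply: (@almost_disjoint_sum _ (fun a => `|pwav f (k a) x|)).
    by move=> a; rewrite normr_ge0 pwav_le.
  move=> a b ab; rewrite -normrM; apply: le_trans kN; apply: le_trans (kk a b x ab).
  by apply: ler_peMl => //; apply: exprn_ege1; rewrite ler1n.
move=> a.
have cab b : a != b -> `|coef (k a) (cwav (k b))| <= kappa.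
  move=> ab; rewrite /coef -torus_integralZ; last exact: coef_integrable.
  rewrite -[leRHS](@torus_integral_cst R d).
  apply: torus_integral_normr_le.
  - by apply: torus_integrableZ; exact: coef_integrable.
  - apply: (@continuous_torus_integrable _ _ _ kappa); first exact: cst_continuous.
    by move=> x; rewrite ger0_norm.
  - move=> x _; rewrite normrM ger0_norm ?exprn_ge0//.
    by have := kk b a x; rewrite eq_sym ab => /(_ isT).
have h : gamma / 2 <= s a * coef (k a) (\sum_b s b *: cwav (k b)).
  rewrite coef_sum; apply: (signed_sum_ge s1 _ _ k0 kg); first exact: kd.
  by move=> b ba; apply: cab; rewrite eq_sym.
rewrite coef_linear.
set X := _ + _; have -> : `|X| = `|s a * X| by rewrite normrM s1 mul1r.
apply: le_trans (ler_norm _); rewrite /X mulrDr sg mulrCA.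
rewrite [leLHS]mulrC; apply: le_trans (ler_wpM2l (ltW e0) h) _.
by rewrite lerDr.
Qed.

End coef.

Lemma Linfty_pairing (R : realType) (d : nat) (U : set 'rV[R]_d)
    (g theta : 'rV[R]_d -> R) (M : R) :
  open U -> measurable_fun U g -> 0 <= M ->
  {ae lebesgue_rV R d, forall x, U x -> `|g x| <= M} ->
  measurable_fun setT theta -> torus_integrable theta -> (forall x, 0 <= theta x) ->
  (forall x, theta x != 0 -> U x) ->
  `|torus_integral (fun x => g x * theta x)| <= M * torus_integral theta.
Proof.
move=> oU mg M0 gM mt it t0 tU.
have mU := open_measurable_rV oU.
have mgt : measurable_fun setT (fun x => g x * theta x).
  (* [g] is measurable on [U] only; as [theta] vanishes outside [U], [g] may be replaced by its
     extension by 0. *)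
  rewrite (_ : (fun _ => _) = (g \_ U) \* theta); last first.
    apply/funext => x /=; rewrite patchE; case: ifPn => // xU.
    have [->|/tU tx] := eqVneq (theta x) 0; first by rewrite !mulr0.
    by rewrite mem_set in xU.
  by apply: measurable_funM => //; apply/(measurable_restrictT _ _).1.
rewrite -torus_integralZ//.
have := torus_integrableZ M it.
rewrite /torus_integral /torus_integrable /Rintegral => iMt.
have mC := @measurable_unit_cube R d.
have fM : (\int[lebesgue_rV R d]_(x in unit_cube R d) (M * theta x)%:E \is a fin_num)%E.
  exact: integrable_fin_num.
have h : (`| \int[lebesgue_rV R d]_(x in unit_cube R d) (g x * theta x)%:E | <=
    \int[lebesgue_rV R d]_(x in unit_cube R d) (M * theta x)%:E)%E.
  apply: le_trans (le_abse_integral _ mC _) _.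
    by apply/measurable_EFinP; exact: measurable_funTS.
  apply: ae_ge0_le_integral => //.
  - by apply: measurableT_comp => //; apply/measurable_EFinP; exact: measurable_funTS.
  - by move=> x _; rewrite lee_fin mulr_ge0.
  - exact: (measurable_int _ iMt).
  - apply: filterS gM => x gx xC; rewrite /= lee_fin normrM (ger0_norm (t0 x)).
    have [->|/tU Ux] := eqVneq (theta x) 0; first by rewrite !mulr0.
    by rewrite ler_wpM2r// gx.
have fg : (\int[lebesgue_rV R d]_(x in unit_cube R d) (g x * theta x)%:E \is a fin_num)%E.
  by rewrite fin_num_abs (le_lt_trans h)// ltey_eq fM.
by rewrite -lee_fin -abse_EFin !fineK.
Qed.

(** The tail intersections increase with [J0], and each lies in some [E J] with [J >= j0]; the bound
    passes to the limit. *)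
Lemma liminf_probability_le (R : realType) (dO : measure_display)
    (Omega : measurableType dO) (P : probability Omega R)
    (E : nat -> set Omega) (j0 : nat) (b : \bar R) :
  (forall J, measurable (E J)) -> (forall J, (j0 <= J)%N -> (P (E J) <= b)%E) ->
  (P (\bigcup_J0 \bigcap_(J in [set J | (J0 <= J)%N]) E J) <= b)%E.
Proof.
move=> mE Eb; pose U J0 := \bigcap_(J in [set J | (J0 <= J)%N]) E J.
have mU J0 : measurable (U J0) by apply: bigcap_measurable => //; exists J0 => /=.
have ndU : nondecreasing_seq U.
  move=> m n mn; apply/subsetPset => w Uw J /= nJ; apply: Uw.
  exact: leq_trans nJ.
have := @nondecreasing_cvg_mu _ _ _ P U mU (bigcup_measurable (fun k _ => mU k)) ndU.
move=> Uc; rewrite -(cvg_lim _ Uc)//; apply: lime_le; first exact: cvgP Uc.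
apply: nearW => J0 /=; apply: le_trans (Eb (maxn J0 j0) (leq_maxr _ _)).
apply: le_measure; rewrite ?inE//; move=> w; apply.
exact: leq_maxl.
Qed.

Lemma big_ord_iota (V : nmodType) (n : nat) (F : nat -> V) :
  \sum_(j < n) F j = \sum_(j <- iota 0 n) F j.
Proof. by rewrite -(big_mkord xpredT F) /index_iota subn0. Qed.

Section wavelet_series.
Context {R : realType} {d : nat} (Psi : 'I_(2 ^ d - 1) -> 'rV[R]_d -> R).
Hypothesis cPsi : forall i, continuous (Psi i).
Hypothesis dPsi : forall i, fast_decay (Psi i).

Definition index_coef (f : 'rV[R]_d -> R) (a : wavelet_index d) : R :=
  wavelet_coef Psi f (tagged a).1 (tag a) (shift_of (tagged a).2).

Definition index_wavelet (a : wavelet_index d) : 'rV[R]_d -> R :=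
  periodized_wavelet Psi (tagged a).1 (tag a) (shift_of (tagged a).2).

Definition scale_indices (J : nat) : seq (wavelet_index d) :=
  [seq existT _ j p | j <- iota 0 J.+1,
     p <- enum {: 'I_(2 ^ d - 1) * 'rV['I_(2 ^ j)]_d}].

Lemma scale_indices_uniq J : uniq (scale_indices J).
Proof.
apply: allpairs_uniq_dep; first exact: iota_uniq.
  by move=> j _; exact: enum_uniq.
by move=> [j p] [j' p'] _ _ /= e; exact: e.
Qed.

Lemma mem_scale_indices J (a : wavelet_index d) :
  (a \in scale_indices J) = (tag a <= J)%N.
Proof.
apply/allpairsPdep/idP => [[j [p [+ _ ->]]]|aJ]; first by rewrite mem_iota.
by exists (tag a), (tagged a); split; [rewrite mem_iota|rewrite mem_enum|case: (a)].
Qed.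

Lemma index_wavelet_continuous a : continuous (index_wavelet a).
Proof.
have [C C1 fC] := fast_decay_periodization_bound (dPsi (tagged a).1).
exact: (periodized_continuous fC C1 (@cPsi (tagged a).1)).
Qed.

Lemma index_wavelet_integrable a (theta : 'rV[R]_d -> R) (B : R) :
  continuous theta -> (forall x, `|theta x| <= B) ->
  torus_integrable (fun x => index_wavelet a x * theta x).
Proof.
move=> ct tB; have [C _ fC] := fast_decay_periodization_bound (dPsi (tagged a).1).
apply: (@continuous_torus_integrable _ _ _ (C * B)).
  by move=> x; apply: continuousM; [exact: index_wavelet_continuous|exact: ct].
by move=> x; rewrite normrM; apply: ler_pM => //; exact: (periodized_le fC).
Qed.

(** Makes the pairing a finite linear form in the variables, the shape that [small_ball_system]
    takes. *)
Lemma series_pairing (dO : measure_display) (Omega : measurableType dO)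
    (P : probability Omega R) (X : wavelet_index d -> {RV P >-> R})
    (f theta : 'rV[R]_d -> R) (B : R) (w : Omega) (J : nat) :
  continuous theta -> (forall x, `|theta x| <= B) ->
  torus_integral (fun x => randomized_series Psi X f w J x * theta x) =
  \sum_(a <- scale_indices J)
    index_coef f a * torus_integral (fun x => index_wavelet a x * theta x) * X a w.
Proof.
move=> ct tB.
have -> : (fun x => randomized_series Psi X f w J x * theta x) =
    (fun x => \sum_(a <- scale_indices J)
       (index_coef f a * X a w) * (index_wavelet a x * theta x)).
  apply/funext => x; rewrite /scale_indices big_allpairs_dep /=.
  rewrite /randomized_series mulr_suml (big_ord_iota J.+1 (fun j =>
    (\sum_(i < 2 ^ d - 1) \sum_(k : 'rV['I_(2 ^ j)]_d)
      wavelet_coef Psi f i j (shift_of k) * X (existT _ j (i, k)) w *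
      periodized_wavelet Psi i j (shift_of k) x) * theta x)).
  apply: eq_bigr => j _; rewrite big_enum /= mulr_suml.
  under [LHS]eq_bigr do rewrite mulr_suml.
  by rewrite pair_bigA /=; apply: eq_bigr => -[i k] _; rewrite mulrA.
have := torus_integral_sum (scale_indices J)
  (f := fun a x => (index_coef f a * X a w) * (index_wavelet a x * theta x)).
move=> /(_ (fun a => torus_integrableZ _ (index_wavelet_integrable a ct tB)))[_ ->].
apply: eq_bigr => a _; rewrite torus_integralZ; last exact: index_wavelet_integrable ct tB.
by rewrite mulrAC.
Qed.

(** Apply [small_ball_system] with [F] the indices of [s] and [G] all others of scale at most [J].
    In the radius, [4 M] comes from the hypothesis of that lemma, [2 / c] from [diag_dominant], and
    [1 / tau] from dividing by the coefficients. *)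
Lemma stage_probability (dO : measure_display) (Omega : measurableType dO)
    (P : probability Omega R) (X : wavelet_index d -> {RV P >-> R})
    (f : 'rV[R]_d -> R) (i0 : 'I_(2 ^ d - 1))
    (c gamma kappa : R) (D : nat) (z : 'rV['I_(2 ^ D)]_d) (N : nat) (j : nat)
    (k : 'I_N -> 'rV['I_(2 ^ j)]_d) (theta : 'I_N -> 'rV[R]_d -> R)
    (s : seq 'I_N) (tau M q : R) (J : nat) :
  independent_rvs X -> 0 < c -> 0 <= kappa -> kappa * N%:R <= c ^+ 2 / 2 ->
  spread_family (Psi i0) c gamma z kappa k theta ->
  (forall a, continuous (theta a)) ->
  uniq s -> 0 < tau -> 0 < M -> 0 <= q ->
  (forall a, a \in s -> tau <= `|wavelet_coef Psi f i0 j (shift_of (k a))|) ->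
  (forall a r, P [set w | (`|X a w - r| <= 8 * M / c / tau)%R] <= q%:E)%E ->
  (j <= J)%N ->
  (P [set w | forall a, a \in s ->
      (`|torus_integral (fun x => randomized_series Psi X f w J x * theta a x)| <=
       M * torus_integral (theta a))%R] <= (q ^+ size s)%:E)%E.
Proof.
move=> indX c0 ka0 kaN [kinj tP [sg sg1 tc] kk _] ct us tau0 M0 q0 stau Xq jJ.
pose phi a : wavelet_index d := existT _ j (i0, k a).
have phi_inj : injective phi.
  move=> a b /eqP; rewrite -tag_eqE /tag_eq /= eqxx /= tagged_asE => /eqP[].
  exact: kinj.
(* Bumps reindexed by wavelet indices, with value 0 off the stage. *)
pose th (b : wavelet_index d) : 'rV[R]_d -> R :=
  if [pick a | phi a == b] is Some a then theta a else fun=> 0.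
have thE a : th (phi a) = theta a.
  by rewrite /th; case: pickP => [b /eqP/phi_inj -> //|/(_ a)]; rewrite eqxx.
pose F := map phi s; pose G := [seq b <- scale_indices J | b \notin F].
have uF : uniq F by rewrite map_inj_uniq.
have FG : perm_eq (scale_indices J) (F ++ G).
  apply: uniq_perm; first exact: scale_indices_uniq.
    rewrite cat_uniq uF filter_uniq ?scale_indices_uniq// andbT /=.
    by apply/hasPn => b; rewrite /G mem_filter => /andP[].
  move=> b; rewrite [b \in F ++ G]mem_cat [b \in G]mem_filter.
  case: (boolP (b \in F)) => //= /mapP[a _ ->].
  by rewrite mem_scale_indices.
pose p a b := torus_integral (fun x => index_wavelet b x * th a x).
pose m a b := index_coef f b * p a b.
have tI a : torus_integrable (theta a).
  have [_ tB _ _] := tP a; exact: continuous_torus_integrable (@ct a) tB.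
have pI a b : torus_integrable (fun x => index_wavelet b x * theta a x).
  have [_ tB _ _] := tP a.
  exact: index_wavelet_integrable (@ct a) tB.
have -> : [set w | forall a, a \in s ->
      `|torus_integral (fun x => randomized_series Psi X f w J x * theta a x)| <=
       M * torus_integral (theta a)] =
    [set w | forall b, b \in F -> `|\sum_(b' <- F ++ G) m b b' * X b' w| <=
       M * torus_integral (th b)].
  have E a w : torus_integral (fun x => randomized_series Psi X f w J x * theta a x) =
      \sum_(b' <- F ++ G) m (phi a) b' * X b' w.
    have [_ tB _ _] := tP a.
    rewrite (series_pairing X f w J (@ct a) tB) (perm_big _ FG) /=.
    by apply: eq_bigr => b _; rewrite /m /p thE.
  apply/seteqP; split => w /= h.
    by move=> _ /mapP[a sa ->]; rewrite thE -E; exact: h.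
  by move=> a sa; have := h _ (map_f phi sa); rewrite thE -E.
rewrite -(size_map phi s); apply: (small_ball_system (B := 8 * M / c / tau)) => //.
- by rewrite -(perm_uniq FG) scale_indices_uniq.
- move=> _ /mapP[a sa ->]; rewrite thE mulr_gt0//.
  by have [] := tP a.
move=> v hv _ /mapP[a0 sa0 ->].
have coefE a : index_coef f (phi a) = wavelet_coef Psi f i0 j (shift_of (k a)) by [].
(* The unknowns are the products of coefficient and variable. On the support of [theta a] its own
   wavelet is at least [c] up to sign, whence the diagonal bound; overlaps at most [kappa] then
   bound the other wavelets by [kappa / c]. *)
have h : forall b, b \in F -> `|index_coef f b * v b| <= 2 * (4 * M) / c.
  apply: (@diag_dominant _ _ F p _ (fun b => torus_integral (th b)) c (kappa / c)) => //.
  - by rewrite divr_ge0// ltW.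
  - rewrite /F size_map; apply: (@le_trans _ _ (kappa / c * N%:R)).
      apply: ler_wpM2l; first by rewrite divr_ge0// ltW.
      rewrite ler_nat; have := max_card (mem s); rewrite card_ord.
      by move/card_uniqP: us => ->.
    rewrite mulrAC ler_pdivrMr//; apply: le_trans kaN _.
    by rewrite expr2 mulrAC.
  - by move=> _ /mapP[a sa ->]; rewrite thE; have [] := tP a.
  - move=> _ /mapP[a sa ->]; rewrite /p thE.
    have [_ _ t0 _] := tP a.
    have -> : `|torus_integral (fun x => index_wavelet (phi a) x * theta a x)| =
        `|sg * torus_integral (fun x => index_wavelet (phi a) x * theta a x)|.
      by rewrite normrM sg1 mul1r.
    apply: le_trans (ler_norm _); rewrite -!torus_integralZ//.
    apply: le_torus_integral; [exact: torus_integrableZ|exact: torus_integrableZ|].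
    move=> x _; rewrite mulrA.
    have [->|tx] := eqVneq (theta a x) 0; first by rewrite !mulr0.
    by apply: ler_wpM2r => //; exact: tc.
  - move=> _ _ /mapP[a sa ->] /mapP[b sb ->] ab; rewrite /p thE.
    have [_ _ t0 _] := tP a.
    rewrite -torus_integralZ//; apply: torus_integral_normr_le => //.
      exact: torus_integrableZ.
    move=> x _; rewrite normrM (ger0_norm (t0 x)).
    have [->|tx] := eqVneq (theta a x) 0; first by rewrite !mulr0.
    apply: ler_wpM2r => //; rewrite ler_pdivlMr//.
    have ab' : a != b by apply: contraNneq ab => ->.
    have ca : c <= `|pwav (Psi i0) (k a) x|.
      by apply: le_trans (tc a x tx) _; rewrite (le_trans (ler_norm _))// normrM sg1 mul1r.
    apply: (@le_trans _ _ (`|pwav (Psi i0) (k a) x * pwav (Psi i0) (k b) x|)).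
      by rewrite normrM mulrC; apply: ler_wpM2r.
    apply: le_trans (kk a b x ab'); apply: ler_peMl => //.
    by apply: exprn_ege1; rewrite ler1n.
  - move=> b bF; have := hv b bF; rewrite mulrA.
    rewrite (eq_bigr (fun b' => p b b' * (index_coef f b' * v b')))//.
    by move=> b' _; rewrite /m mulrA [p _ _ * _]mulrC.
have := h _ (map_f phi sa0); rewrite normrM coefE => hb.
rewrite ler_pdivlMr//; have -> : 8 * M / c = 2 * (4 * M) / c by lra.
by apply: le_trans hb; rewrite mulrC; apply: ler_wpM2r => //; exact: stau.
Qed.

End wavelet_series.

(** * Locally bounded series *)

Lemma invariant_dyadic_cube (R : realType) (d : nat) (U : set 'rV[R]_d) :
  open U -> torus_invariant U -> U !=set0 ->
  exists D (z : 'rV['I_(2 ^ D)]_d), dyadic_cube D (shift_of z) `<=` U.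
Proof.
move=> oU iU [x Ux].
pose l : 'rV[int]_d := \row_i (- Num.floor (x 0 i)).
pose y := x + map_mx intr l.
have Uy : U y by apply: (iU x l).1.
have y01 i : 0 <= y 0 i < 1.
  rewrite !mxE intrN subr_ge0 floor_le /= ltrBlDl.
  by have := floorD1_gt (x 0 i); rewrite intrD addrC.
have [D DU] := open_dyadic_cube oU Uy.
have D0 : 0 < 2 ^+ D :> R by rewrite exprn_gt0.
have zP i : exists z : 'I_(2 ^ D), (z : nat)%:Z = Num.floor (2 ^+ D * y 0 i).
  have /andP[y0 y1] := y01 i.
  have f0 : 0 <= Num.floor (2 ^+ D * y 0 i) by rewrite floor_ge0 mulr_ge0// ltW.
  have f1 : Num.floor (2 ^+ D * y 0 i) < (2 ^ D)%:Z.
    rewrite -(ltr_int R); apply: le_lt_trans (floor_le _) _.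
    by rewrite -pmulrn natrX -[ltRHS]mulr1 ltr_pM2l.
  case: (Num.floor (2 ^+ D * y 0 i)) f0 f1 => [n|//] _; rewrite ltz_nat => nD.
  by exists (Ordinal nD).
have /choice[z zE] := zP.
exists D, (\row_i z i) => v; rewrite (_ : shift_of _ = dyadic_index D y); first exact: DU.
by apply/rowP => i; rewrite !mxE zE !mxE.
Qed.

(** The limit pairing is at most [|M|] times the integral of [theta], and the gap up to [M'] absorbs
    the convergence in [J]. Only a cube is kept of the open set, so [theta] must be a test function
    for every invariant set containing that cube. *)
Lemma locally_bounded_pairing (R : realType) (d : nat) (S : nat -> 'rV[R]_d -> R) :
  ~ nowhere_locally_bounded S ->
  exists D (z : 'rV['I_(2 ^ D)]_d) (M : R), forall theta (B M' : R),
    (forall U, torus_invariant U -> dyadic_cube D (shift_of z) `<=` U ->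
       test_function U theta) ->
    (forall x, `|theta x| <= B) -> (forall x, 0 <= theta x) ->
    0 < torus_integral theta -> M < M' ->
    \forall J \near \oo,
      `|torus_integral (fun x => S J x * theta x)| <= M' * torus_integral theta.
Proof.
move=> /contrapT[U [oU iU U0 [g [mg _ [M gM]] cvgS]]].
have [D [z zU]] := invariant_dyadic_cube oU iU U0.
exists D, z, `|M| => theta B M' test thetaB theta0 Itheta MM.
have tU : test_function U theta by exact: test.
have [st _ cU] := tU.
have ct : continuous theta by exact: (st [::]).1.
have it : torus_integrable theta by exact: continuous_torus_integrable ct thetaB.
have gt : `|torus_integral (fun x => g x * theta x)| <= `|M| * torus_integral theta.
  apply: (@Linfty_pairing _ _ U) => //.
  - by apply: filterS gM => x gx Ux; apply: le_trans (gx Ux) (ler_norm _).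
  - exact: continuous_measurable_rV.
  - by move=> x tx; apply: cU; exact: subset_closure.
have := cvgS theta tU; move/cvgrPdist_le/(_ ((M' - `|M|) * torus_integral theta)).
rewrite mulr_gt0 ?subr_gt0// => /(_ isT); apply: filterS => J.
set p := torus_integral _ in gt *; set s := torus_integral (fun x => S J x * _) => ps.
rewrite -[s](subrK p); apply: le_trans (ler_normD _ _) _; rewrite distrC.
have : (M' - `|M|) * torus_integral theta + `|M| * torus_integral theta = M' * torus_integral theta.
  by rewrite -mulrDl subrK.
by move=> <-; exact: lerD.
Qed.

Lemma wavelet_neq0 (R : realType) (d r : nat) (phi : 'rV[R]_d -> R)
    (Psi : 'I_(2 ^ d - 1) -> 'rV[R]_d -> R) i :
  orthonormal_wavelet_basis r phi Psi -> exists y, Psi i y != 0.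
Proof.
move=> [_ _ [_ on _]]; apply: contrapT => Psi0.
have {}Psi0 y : Psi i y = 0.
  by apply/eqP; apply/negPn/negP => h; apply: Psi0; exists y.
have := on (inr (i, 0%N, 0)) (inr (i, 0%N, 0)).
rewrite eqxx /= (_ : (fun x => _) = cst 0); last first.
  by apply/funext => x; rewrite Psi0 mulr0 mulr0.
by rewrite Rintegral_cst// mul0r => /esym/eqP; rewrite oner_eq0.
Qed.

Lemma measurable_pairing_le (R : realType) (d : nat) (Psi : 'I_(2 ^ d - 1) -> 'rV[R]_d -> R)
    (dO : measure_display) (Omega : measurableType dO)
    (P : probability Omega R) (X : wavelet_index d -> {RV P >-> R})
    (f theta : 'rV[R]_d -> R) (B b : R) (J : nat) :
  (forall i, continuous (Psi i)) -> (forall i, fast_decay (Psi i)) ->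
  continuous theta -> (forall x, `|theta x| <= B) ->
  measurable [set w | `|torus_integral (fun x => randomized_series Psi X f w J x * theta x)| <= b].
Proof.
move=> cPsi dPsi ct tB.
pose T w := \sum_(a <- (scale_indices J : seq (wavelet_index d)))
    index_coef Psi f a * torus_integral (fun x => index_wavelet Psi a x * theta x) * X a w.
rewrite (_ : [set w | _] = T @^-1` `[- b, b]); last first.
  by apply/seteqP; split => w; rewrite /= in_itv /= -ler_norml (series_pairing cPsi dPsi X f w J ct tB).
rewrite -[X in measurable X]setTI.
have mT : measurable_fun setT T.
  by apply: measurable_sum => a; apply: measurable_funM.
by apply: mT => //; exact: measurable_itv.
Qed.

(** * Stages, resonance events and the almost sure conclusion *)

Record stage (R : realType) (d : nat) := Stage {
  stage_half : nat;
  stage_scale : nat;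
  stage_shift : 'I_(2 * stage_half) -> 'rV['I_(2 ^ stage_scale)]_d;
  stage_bump : 'I_(2 * stage_half) -> 'rV[R]_d -> R }.

Section main.
Context {R : realType} {d : nat} (Psi : 'I_(2 ^ d - 1) -> 'rV[R]_d -> R)
  (i0 : 'I_(2 ^ d - 1)) (c gamma : R).
Context {dO : measure_display} {Omega : measurableType dO}
  (P : probability Omega R) (chi : {RV P >-> R}).
Hypothesis c_gt0 : 0 < c.
Hypothesis gamma_gt0 : 0 < gamma.

(* [logn 2 n.+1] takes each value infinitely often, so each cube occurs infinitely
   often. *)
Definition cube_of (n : nat) : {D : nat & 'rV['I_(2 ^ D)]_d} :=
  odflt (existT (fun D => 'rV['I_(2 ^ D)]_d) 0%N (\row_i Ordinal (isT : (0 < 2 ^ 0)%N)))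
    (pickle_inv (logn 2 n.+1)).

Lemma cube_ofE (D : nat) (z : 'rV['I_(2 ^ D)]_d) (n : nat) :
  logn 2 n.+1 = pickle (existT (fun D => 'rV['I_(2 ^ D)]_d) D z) ->
  cube_of n = existT _ D z.
Proof. by rewrite /cube_of => ->; rewrite pickleK_inv. Qed.

Lemma logn2_often (a m : nat) : exists2 n, (m <= n)%N & logn 2 n.+1 = a.
Proof.
(* [n + 1 = 2^a (2m + 1)], with odd second factor. *)
exists (2 ^ a * (2 * m).+1).-1.
  rewrite -ltnS prednK ?muln_gt0 ?expn_gt0//.
  have : (0 < 2 ^ a)%N by rewrite expn_gt0.
  nia.
rewrite prednK ?muln_gt0 ?expn_gt0// lognM ?expn_gt0// pfactorK// logn_coprime ?addn0//.
by rewrite coprime2n /= oddM.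
Qed.

(** The three bounds serve, in order, the norm of the signed sums in [almost_disjoint_sum], the
    cross terms in [perturbation], and the diagonal dominance in [stage_probability]. *)
Definition overlap (N : nat) : R :=
  Num.min (N.+1%:R^-1 ^+ 2) (Num.min (gamma / 2) (c ^+ 2 / 2) / N.+1%:R).

Lemma overlap_gt0 N : 0 < overlap N.
Proof.
have h : 0 < N.+1%:R :> R by rewrite ltr0n.
rewrite lt_min exprn_gt0 ?invr_gt0//= divr_gt0// lt_min !divr_gt0//.
by rewrite exprn_gt0.
Qed.

Lemma overlap_le1 N : overlap N <= N.+1%:R^-1 ^+ 2.
Proof. by rewrite ge_min lexx. Qed.

Lemma overlap_le2 N : overlap N * N%:R <= gamma / 2 /\ overlap N * N%:R <= c ^+ 2 / 2.
Proof.
have h : 0 < N.+1%:R :> R by rewrite ltr0n.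
have : overlap N * N%:R <= Num.min (gamma / 2) (c ^+ 2 / 2).
  apply: (@le_trans _ _ (overlap N * N.+1%:R)).
    by rewrite ler_pM2l ?overlap_gt0// ler_nat.
  by rewrite -ler_pdivlMr// ge_min lexx orbT.
by rewrite le_min => /andP.
Qed.

(** One half is lost to the cross terms in [perturbation], the other to the later stages in
    [probe_exists]; the power of 2 is the one in [good]. *)
Definition threshold (n : nat) (eps : R) : R := gamma / 2 / 2 * eps / (2 ^ n.+1)%:R.

(** The radius is that of [stage_probability] for [M = n + 1] and [tau = threshold n eps]. It does
    not involve the number of indices, so [stage_half] can be chosen after [q]. *)
Definition stage_ok (n : nat) (eps : R) (S : stage R d) : Prop :=
  spread_family (Psi i0) c gamma (projT2 (cube_of n)) (overlap (2 * stage_half S))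
    (@stage_shift _ _ S) (@stage_bump _ _ S) /\
  exists q : R, [/\ 0 <= q <= 1,
    forall r, (P [set w | (`|chi w - r| <= 8 * n.+1%:R / c / threshold n eps)%R] <= q%:E)%E &
    q ^+ stage_half S <= n.+1%:R^-1].

Lemma stage_exists (n : nat) (eps : R) : unbounded_rv chi ->
  (forall (D : nat) (z : 'rV['I_(2 ^ D)]_d) (N : nat) (kappa : R), 0 < kappa ->
    exists j (k : 'I_N -> 'rV['I_(2 ^ j)]_d) theta,
      spread_family (Psi i0) c gamma z kappa k theta) ->
  exists S, stage_ok n eps S.
Proof.
move=> chiu spr.
have [q /andP[q0 q1] qP] := unbounded_anti_concentration (8 * n.+1%:R / c / threshold n eps) chiu.
have [h hq] : exists h, q ^+ h <= n.+1%:R^-1.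
  have : q ^+ k @[k --> \oo] --> (0 : R) by apply: cvg_expr; rewrite ger0_norm.
  move/cvgrPdist_le/(_ n.+1%:R^-1); rewrite invr_gt0 ltr0n => /(_ isT)[h _ /(_ h (leqnn h))] /=.
  rewrite sub0r normrN => qh; exists h; exact: le_trans (ler_norm _) qh.
have [j [k [theta kt]]] := spr _ (projT2 (cube_of n)) (2 * h)%N _ (overlap_gt0 (2 * h)).
exists (Stage k theta); split => //.
by exists q; split => //; rewrite q0 ltW.
Qed.

Context (X : wavelet_index d -> {RV P >-> R}).
Hypothesis cPsi : forall i, continuous (Psi i).
Hypothesis dPsi : forall i, fast_decay (Psi i).
Hypothesis iidX : iid_of_law X chi.

Section resonance.
Context (S : nat -> stage R d) (eps : nat -> R) (f : ctorus R d) (n0 : nat).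
Hypothesis eps_gt0 : forall n, 0 < eps n.
Hypothesis S_ok : forall n, stage_ok n (eps n) (S n).
Hypothesis f_large : forall n, (n0 <= n)%N ->
  (stage_half (S n) <=
     #|[pred a | (threshold n (eps n) <= `|coef (Psi i0) (@stage_shift _ _ (S n) a) f|)%R]|)%N.

Definition large_shifts n :=
  enum [pred a | (threshold n (eps n) <= `|coef (Psi i0) (@stage_shift _ _ (S n) a) f|)%R].

Definition pairing_event n J := [set w | forall a, a \in large_shifts n ->
  `|torus_integral (fun x => randomized_series Psi X f w J x * stage_bump a x)| <=
  n.+1%:R * torus_integral (@stage_bump _ _ (S n) a)].

Lemma stage_bump_continuous n a : continuous (@stage_bump _ _ (S n) a).
Proof.
have [[_ /(_ a)[tU _ _ _] _ _ _] _] := S_ok n.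
by have [st _ _] := tU setT (fun x l => conj (fun=> I) (fun=> I)) (@subsetT _ _); exact: (st [::]).1.
Qed.

Lemma measurable_pairing_event n J : measurable (pairing_event n J).
Proof.
rewrite (_ : pairing_event n J = \bigcap_(a in [set` large_shifts n])
    [set w | `|torus_integral (fun x => randomized_series Psi X f w J x * stage_bump a x)| <=
       n.+1%:R * torus_integral (@stage_bump _ _ (S n) a)]); last by [].
apply: fin_bigcap_measurable => // a _.
have [[_ /(_ a)[_ tB _ _] _ _ _] _] := S_ok n.
exact: (@measurable_pairing_le _ _ Psi _ _ P X f _ _ _ J cPsi dPsi (@stage_bump_continuous n a) tB).
Qed.

Lemma pairing_event_probability n J : (n0 <= n)%N -> (stage_scale (S n) <= J)%N ->
  (P (pairing_event n J) <= (n.+1%:R^-1)%:E)%E.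
Proof.
move=> n0n SJ; have [sf [q [/andP[q0 q1] qP qn]]] := S_ok n.
have [indX idX] := iidX.
have tau0 : 0 < threshold n (eps n).
  by rewrite /threshold !divr_gt0 ?mulr_gt0 ?divr_gt0// ltr0n expn_gt0.
apply: (@le_trans _ _ (q ^+ size (large_shifts n))%:E).
  apply: (@stage_probability R d Psi cPsi dPsi _ _ P X f i0 c gamma _ _ _ _ _ _ _
    (large_shifts n) (threshold n (eps n)) n.+1%:R q J indX c_gt0 (ltW (overlap_gt0 _))
    (overlap_le2 _).2 sf (@stage_bump_continuous n) (enum_uniq _) tau0) => //.
    by move=> a; rewrite mem_enum.
  move=> a r; apply: le_trans (qP r).
  set B := 8 * _ / _ / _.
  have mB : measurable `[r - B, r + B]%classic by exact: measurable_itv.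
  have XE (Y : {RV P >-> R}) : [set w | `|Y w - r| <= B] = Y @^-1` `[r - B, r + B]%classic.
    by apply/seteqP; split => w; rewrite /= in_itv /= ler_distl.
  by rewrite !XE; have := idX a _ mB; rewrite /distribution /pushforward => ->.
rewrite lee_fin; apply: le_trans qn.
by rewrite ler_wiXn2l// -cardE; exact: f_large.
Qed.

(** The lower limit of the pairing events as [J] grows, since convergence in distributions only
    controls large [J]. *)
Definition resonance n := \bigcup_J0 \bigcap_(J in [set J | (J0 <= J)%N]) pairing_event n J.

Lemma measurable_resonance n : measurable (resonance n).
Proof.
apply: bigcup_measurable => J0 _; apply: bigcap_measurable; first by exists J0 => /=.
by move=> J _; exact: measurable_pairing_event.
Qed.

Lemma resonance_probability n : (n0 <= n)%N -> (P (resonance n) <= (n.+1%:R^-1)%:E)%E.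
Proof.
move=> n0n; apply: (@liminf_probability_le _ _ _ P _ (stage_scale (S n))).
  exact: measurable_pairing_event.
by move=> J; exact: pairing_event_probability.
Qed.

(** All stages with [logn 2 n.+1 = a] sit in the same cube; boundedness there makes all of them
    resonate from some rank [m] on. *)
Definition recurrent_resonance (a m : nat) :=
  \bigcap_(n in [set n | [&& m <= n, n0 <= n & logn 2 n.+1 == a]%N]) resonance n.

(** It is contained in resonances of arbitrarily late stages, of probability at most
    [1 / (n + 1)]. *)
Lemma recurrent_resonance_negligible a m : P.-negligible (recurrent_resonance a m).
Proof.
have [n1 n1m n1a] := logn2_often a (maxn m n0).
have mZ : measurable (recurrent_resonance a m).
  apply: bigcap_measurable; last by move=> n _; exact: measurable_resonance.
  by exists n1 => /=; move: n1m; rewrite geq_max => /andP[-> ->]; rewrite n1a eqxx.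
exists (recurrent_resonance a m); split => //.
apply/eqP; rewrite eq_le measure_ge0 andbT; apply/lee_addgt0Pr => e e0; rewrite add0e.
have [n] := logn2_often a (maxn (maxn m n0) (Num.truncn e^-1)).
rewrite !geq_max => /andP[/andP[mn n0n] ne] na.
apply: (@le_trans _ _ (P (resonance n))).
  apply: le_measure; rewrite ?inE//; first exact: measurable_resonance.
  by move=> w; apply => /=; rewrite mn n0n na eqxx.
apply: le_trans (resonance_probability n0n) _; rewrite lee_fin invf_ple ?posrE//.
apply: ltW; apply: lt_le_trans (truncnS_gt _) _.
by rewrite ler_nat ltnS.
Qed.

Lemma bounded_recurrent_resonance w :
  ~ nowhere_locally_bounded (randomized_series Psi X f w) ->
  exists a m, recurrent_resonance a m w.
Proof.
move=> /locally_bounded_pairing[D [z [M DM]]].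
(* From the integer part of [M] on, [n + 1] exceeds [M]. *)
exists (pickle (existT (fun D => 'rV['I_(2 ^ D)]_d) D z)), (Num.truncn M) =>
  n /= /and3P[mn n0n /eqP na].
have [[_ tP _ _ _] _] := S_ok n; have zn := cube_ofE na.
have Mn : M < n.+1%:R by apply: lt_le_trans (truncnS_gt _) _; rewrite ler_nat.
have aP a : exists J0, forall J, (J0 <= J)%N ->
    `|torus_integral (fun x => randomized_series Psi X f w J x * stage_bump a x)| <=
     n.+1%:R * torus_integral (@stage_bump _ _ (S n) a).
  have [tU tB tge tgt] := tP a; move: tU; rewrite zn /= => tU.
  by have [J0 _ J0P] := DM _ _ _ tU tB tge tgt Mn; exists J0.
have /choice[J0 J0P] := aP.
exists (\max_a J0 a) => // J /= JJ a _; apply: J0P.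
exact: leq_trans (leq_bigmax _) JJ.
Qed.

Lemma resonant_nowhere_bounded :
  {ae P, forall w, nowhere_locally_bounded (randomized_series Psi X f w)}.
Proof.
apply: (@negligibleS _ _ _ _ (\bigcup_a \bigcup_m recurrent_resonance a m)).
  by move=> w /= /bounded_recurrent_resonance[a [m amw]]; exists a => //; exists m.
by apply: negligible_bigcup => a; apply: negligible_bigcup => m;
  exact: recurrent_resonance_negligible.
Qed.

End resonance.
End main.

Theorem theorem3p5 (R : realType) (d : nat)
    (phi : 'rV[R]_d -> R) (Psi : 'I_(2 ^ d - 1) -> 'rV[R]_d -> R)
    (dO : measure_display) (Omega : measurableType dO)
    (P : probability Omega R) (chi : {RV P >-> R})
    (X : wavelet_index d -> {RV P >-> R}) :
  (0 < d)%N ->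
  orthonormal_wavelet_basis 0 phi Psi ->
  (forall i, continuous (Psi i)) ->
  iid_of_law X chi ->
  unbounded_rv chi ->
  prevalent [set f : ctorus R d |
    {ae P, forall w, nowhere_locally_bounded (randomized_series Psi X f w)}].
Proof.
move=> d0 ob cPsi [indX idX] chiu.
have dPsi i : fast_decay (Psi i) by have [_ h _] := ob; exact: (h i).2 [::] isT.
have i0 : 'I_(2 ^ d - 1).
  by apply: (@Ordinal _ 0); rewrite subn_gt0 -{1}(expn0 2) ltn_exp2l.
have [y0 fy0] := wavelet_neq0 i0 ob.
have [C C1 fC] := fast_decay_periodization_bound (dPsi i0).
have [c [gamma [c0 gamma0 spr]]] := spread_family_exists (@cPsi i0) fC C1 d0 fy0.
have C0 : 0 < C by apply: lt_le_trans C1.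
have /choice[stg stgP] : forall p : nat * R, exists S, stage_ok Psi i0 c gamma chi p.1 p.2 S.
  by move=> [n eps]; exact: stage_exists.
pose adm (S : stage R d) (l : ctorus R d -> R) :=
  exists a, l = coef (Psi i0) (stage_shift a : 'rV['I_(2 ^ stage_scale S)]_d).
(* The functionals of a stage are the coefficients at its shifts, bounded by [2^(dj) C];
   [perturbation] supplies [adm_perturb] with norm [C + 1] and constant [gamma / 2]. *)
have [g [eps [eps0 glow]]] : exists (g : ctorus R d) (eps : nat -> R), (forall n, 0 < eps n) /\
    forall n l, adm (stg (n, eps n)) l -> gamma / 2 / 2 * eps n <= `|l g|.
  apply: (@probe_exists R (ctorus R d) (stage R d) (fun n e => stg (n, e)) adm
    (fun S => 2 ^+ (d * stage_scale S) * C) (C + 1) (gamma / 2)).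
  - by move=> S; rewrite mulr_gt0// exprn_gt0.
  - by rewrite addr_gt0.
  - by rewrite divr_gt0.
  - by move=> S _ [a ->] x y t; exact: (coef_linear (@cPsi i0) fC C1).
  - by move=> S _ [a ->] x; exact: (coef_bound (@cPsi i0) fC C1).
  - move=> n e x e0; have [sf _] := stgP (n, e).
    have [b [bC bl]] := perturbation (@cPsi i0) fC C1 x sf (ltW (overlap_gt0 c0 gamma0 _))
       (overlap_le1 _ _ _) (overlap_le2 c0 gamma0 _).1 e0.
    by exists b; split => // _ [a ->]; exact: bl.
pose Sn n := stg (n, eps n).
pose h n := stage_half (Sn n).
pose l n (a : 'I_(2 * h n)) : ctorus R d -> R := coef (Psi i0) (@stage_shift _ _ (Sn n) a).
pose beta n := gamma / 2 / 2 * eps n.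
have beta0 n : 0 < beta n by rewrite mulr_gt0// !divr_gt0.
exists (lim_sup_set (fun n => ~` good l beta n)).
  apply: (@haar_null_limsup_bad _ _ h l g beta) => //.
  - by move=> n a; exact: (coef_continuous (@cPsi i0) fC C1).
  - move=> n a t x; have linl := coef_linear (@cPsi i0) fC C1 (@stage_shift _ _ (Sn n) a).
    have l0 : l n a 0 = 0 by have := linl 0 0 (-1); rewrite scaler0 addr0 mulN1r subrr.
    by rewrite -scaleN1r addrC -[-1 *: x]add0r /l !linl -/(l n a 0) l0 add0r mulN1r addrC.
  - by move=> n a; apply: glow; exists a.
(* Outside the upper limit of the bad sets, [f] is good from some rank [n0] on, which is the
   largeness of coefficients that the resonance argument assumes. *)
move=> f; apply: contraPP => fgood.
have [n0 n0P] : exists n0, forall n, (n0 <= n)%N -> good l beta n f.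
  apply: contrapT => nogood; apply: fgood => n _ /=; apply: contrapT => nn; apply: nogood.
  by exists n => k nk; apply: contrapT => kbad; apply: nn; exists k.
apply; exact: (@resonant_nowhere_bounded R d Psi i0 c gamma _ _ P chi c0 gamma0 X cPsi dPsi
  (conj indX idX) Sn eps f n0 eps0 (fun n => stgP (n, eps n)) n0P).
Qed.
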